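(* Let $M=(M',\mathbf{m})\in\mathbb{M}(2\times3,\mathbb{F}_q)$ be such that $g_{M'}$ is reducible over $\mathbb{F}_q$ or is the zero polynomial. (I) If $g_{M'}=0$ has two distinct roots in $\mathbb{P}^1$, then the number of $\mathbb{F}_q$-points at infinity of $V_M$ is two. Moreover: (I-1) if $\det M'\neq0$, then $V_M$ is $\mathcal{B}$-equivalent to a curve $$xy\bigl(a_1x^{q-1}+b_0y^{q-1}-(a_1+b_0)z^{q-1}\bigr)=0$$ with $a_1,b_0\in\mathbb{F}_q$ and $a_1b_0(a_1+b_0)\neq0$; the nonlinear component is a curve of type (T2); (I-2) if $\det M'=0$ and $\operatorname{rank}M=2$, then $V_M$ is $\mathcal{B}$-equivalent to the curve $$y(x^q-xz^{q-1}+y^{q-1}z-z^q)=0;$$ the nonlinear component is a curve of type (T3); (I-3) if $\det M'=0$ and $\operatorname{rank}M=1$, then $V_M$ is $\mathcal{B}$-equivalent to the curve $$y(x^q-xz^{q-1})=0,$$ which consists of $q$ lines passing through $(0,1,0)$ and another line not passing through that point. (II) If $g_{M'}=0$ has a double root in $\mathbb{P}^1$, then the number of $\mathbb{F}_q$-points at infinity of $V_M$ is one. Moreover: (II-1) if $\det M'\neq0$, then $V_M$ is $\mathcal{B}$-equivalent to the curve $$x(x^q-xz^{q-1}+yx^{q-1}-y^q)=0;$$ the nonlinear component is a curve of type (T3); (II-2) if $\det M'=0$ and $\operatorname{rank}M=2$, then $V_M$ is $\mathcal{B}$-equivalent to the curve $$x^{q+1}-x^2z^{q-1}+y^qz-yz^q=0,$$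 which is nonsingular; (II-3) if $\det M'=0$ and $\operatorname{rank}M=1$, then $V_M$ is $\mathcal{B}$-equivalent to the curve $$x^2(x^{q-1}-z^{q-1})=0,$$ which consists of $q-1$ simple lines and one double line, all passing through a common point. (III) If $g_{M'}$ is the zero polynomial, then $V_M(\mathbb{F}_q)=\mathbb{P}^2(\mathbb{F}_q)$ if $V_M$ exists (i.e. if $G_M$ is not the zero polynomial). Moreover: (III-1) if $\det M'\neq0$, then $V_M$ is $\mathcal{B}$-equivalent to the curve $x^qy-xy^q=0$, which is the union of the $q+1$ $\mathbb{F}_q$-lines passing through $(0,0,1)$; (III-2) there is no $M$ for which $g_{M'}$ is the zero polynomial, $\det M'=0$ and $\operatorname{rank}M=2$; (III-3) if $\det M'=0$ and $\operatorname{rank}M=1$, then $V_M$ is $\mathcal{B}$-equivalent to the curve $x^qz-xz^q=0$, which is the union of the $q+1$ $\mathbb{F}_q$-lines passing through $(0,1,0)$.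
   Context: $\mathbb{F}_q$ is a finite field with $q$ elements; $x,y,z$ are homogeneous coordinates on $\mathbb{P}^2$; $\mathbb{M}(2\times3,\mathbb{F}_q)$ is the set of $2\times3$ matrices over $\mathbb{F}_q$. For $M=\begin{pmatrix}a_0&a_1&a_2\\ b_0&b_1&b_2\end{pmatrix}\in\mathbb{M}(2\times3,\mathbb{F}_q)$ write $M=(M',\mathbf{m})$ with $M'=\begin{pmatrix}a_0&a_1\\ b_0&b_1\end{pmatrix}$ and $\mathbf{m}=\begin{pmatrix}a_2\\ b_2\end{pmatrix}$. Let $$g_{M'}(s,t)=(s,t)\,M'\begin{pmatrix}s\\ t\end{pmatrix},\qquad G_M(x,y,z)=(x^q-xz^{q-1},\,y^q-yz^{q-1})\,M\begin{pmatrix}x\\ y\\ z\end{pmatrix},$$ and let $V_M=\{G_M=0\}\subset\mathbb{P}^2$. Roots of $g_{M'}=0$ are taken in $\mathbb{P}^1$ (coordinates $(s,t)$). ''Has a double root'' means that $g_{M'}$ is nonzero and has a single root of multiplicity two. The number of $\mathbb{F}_q$-points at infinity of $V_M$ is $|V_M(\mathbb{F}_q)\cap\{z=0\}|$. Two curves are $\mathcal{B}$-equivalent if some projective transformation $\sigma$ of $\mathbb{P}^2$ over $\mathbb{F}_q$ with $\sigma(\{z=0\})=\{z=0\}$ maps one onto the other, i.e. a transformation given by a matrix $\begin{pmatrix}B&\mathbf{b}\\ 0&\lambda\end{pmatrix}$ with $B\in GL(2,\mathbb{F}_q)$, $\mathbf{b}\in\mathbb{F}_q^2$, $\lambda\in\mathbb{F}_q^*$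 (curves are considered with their defining equations up to a nonzero scalar, so multiplicities are preserved). Types of curves: (T2) curves projectively equivalent over $\mathbb{F}_q$ to a curve $\alpha x^{q-1}+\beta y^{q-1}+\gamma z^{q-1}=0$ with $\alpha,\beta,\gamma\in\mathbb{F}_q$, $\alpha\beta\gamma\neq0$, $\alpha+\beta+\gamma=0$; (T3) curves projectively equivalent over $\mathbb{F}_q$ to $x^q-xz^{q-1}+x^{q-1}y-y^q=0$. *)

(* Defs.v *)
From HB Require Import structures.
From mathcomp Require Import all_boot all_order all_algebra.
From mathcomp Require Import mpoly.

Set Implicit Arguments.
Unset Strict Implicit.
Unset Printing Implicit Defensive.

Import GRing.Theory.
Local Open Scope ring_scope.

(* A plane curve over F is given by its equation f : {mpoly F[3]}, considered
   up to a nonzero scalar. *)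
Definition same_curve (F : fieldType) (f g : {mpoly F[3]}) : Prop :=
  exists2 c : F, c != 0 & f = c *: g.

Definition xvar (F : fieldType) : {mpoly F[3]} := 'X_(@Ordinal 3 0 isT).
Definition yvar (F : fieldType) : {mpoly F[3]} := 'X_(@Ordinal 3 1 isT).
Definition zvar (F : fieldType) : {mpoly F[3]} := 'X_(@Ordinal 3 2 isT).

Definition gpoly (F : fieldType) (M' : 'M[F]_2) : {mpoly F[2]} :=
  let st : 'rV[{mpoly F[2]}]_2 := \row_i 'X_i in
  (st *m map_mx (@mpolyC 2 F) M' *m st^T) 0 0.

(* The square part of M, i.e. its first two columns. *)
Definition lpart (F : fieldType) (M : 'M[F]_(2, 3)) : 'M[F]_2 :=
  lsubmx (M : 'M[F]_(2, 2 + 1)).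

Definition Gpoly (F : finFieldType) (M : 'M[F]_(2, 3)) : {mpoly F[3]} :=
  let q := #|F| in
  let x := xvar F in let y := yvar F in let z := zvar F in
  let u : 'rV[{mpoly F[3]}]_2 :=
    \row_i [:: x ^+ q - x * z ^+ q.-1; y ^+ q - y * z ^+ q.-1]`_i in
  let v : 'cV[{mpoly F[3]}]_3 := \col_j [:: x; y; z]`_j in
  (u *m map_mx (@mpolyC 3 F) M *m v) 0 0.

(* Irreducible, resp. reducible, over the coefficient field; [msize] is the
   total degree plus one, so [1 < msize a] says that a is not constant.  The
   zero polynomial is neither irreducible nor reducible. *)
Definition mirreducible (K : fieldType) (n : nat) (f : {mpoly K[n]}) : Prop :=
  (1 < msize f)%N /\
  forall a b : {mpoly K[n]}, f = a * b -> (msize a <= 1)%N \/ (msize b <= 1)%N.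

Definition mreducible (K : fieldType) (n : nat) (f : {mpoly K[n]}) : Prop :=
  exists a b : {mpoly K[n]}, [/\ (1 < msize a)%N, (1 < msize b)%N & f = a * b].

(* Points of the projective space P^(n-1)(F): the classes of the nonzero
   vectors of F^n under multiplication by nonzero scalars. *)
Definition ppoint (F : finFieldType) (n : nat) (v : 'rV[F]_n) : {set 'rV[F]_n} :=
  [set c *: v | c in [set c : F | c != 0]].

Definition pspace (F : finFieldType) (n : nat) : {set {set 'rV[F]_n}} :=
  [set ppoint v | v in [set v : 'rV[F]_n | v != 0]].

(* The rational points of the zero locus of a homogeneous polynomial f. *)
Definition pzeros (F : finFieldType) (n : nat) (f : {mpoly F[n]}) :
    {set {set 'rV[F]_n}} :=
  [set ppoint v | v in [set v : 'rV[F]_n | (v != 0) && (f.@[v 0] == 0)]].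

Definition nb_points_at_infinity (F : finFieldType) (f : {mpoly F[3]}) : nat :=
  #|pzeros f :&: pzeros (zvar F)|.

(* The point p of P^1 is the zero of the linear form p_1 s - p_0 t; p is a
   root of multiplicity m when exactly the m-th power of that form divides. *)
Definition root_of_multiplicity (F : fieldType) (g : {mpoly F[2]})
    (p : 'rV[F]_2) (m : nat) : Prop :=
  exists2 h : {mpoly F[2]},
    g = (p 0 1 *: 'X_0 - p 0 0 *: 'X_1) ^+ m * h & h.@[p 0] != 0.

(* When g is a reducible binary quadratic form all its roots in P^1 are
   F-rational, hence they may be taken in P^1(F). *)
Definition has_two_distinct_roots (F : finFieldType) (g : {mpoly F[2]}) : Prop :=
  g != 0 /\ #|pzeros g| = 2%N.

Definition has_double_root (F : finFieldType) (g : {mpoly F[2]}) : Prop :=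
  g != 0 /\ exists p : 'rV[F]_2,
    [/\ p != 0, pzeros g = [set ppoint p] & root_of_multiplicity g p 2].

(* The polynomial v |-> f (A v), for column vectors v. *)
Definition lin_subst (F : fieldType) (A : 'M[F]_3) (f : {mpoly F[3]}) :
    {mpoly F[3]} :=
  f \mPo [tuple \sum_(j < 3) A i j *: 'X_j | i < 3].

(* v |-> A v maps the curve f = 0 onto the curve g = 0. *)
Definition maps_onto (F : fieldType) (A : 'M[F]_3) (f g : {mpoly F[3]}) : Prop :=
  same_curve (lin_subst A g) f.

Definition proj_equiv (F : fieldType) (f g : {mpoly F[3]}) : Prop :=
  exists2 A : 'M[F]_3, A \in unitmx & maps_onto A f g.

Definition B_equiv (F : fieldType) (f g : {mpoly F[3]}) : Prop :=
  exists (B : 'M[F]_2) (b : 'cV[F]_2) (l : F),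
    [/\ B \in unitmx, l != 0 &
        maps_onto (block_mx B b 0 l%:M : 'M[F]_(2 + 1)) f g].

Definition type_T2 (F : finFieldType) (f : {mpoly F[3]}) : Prop :=
  let q := #|F| in
  exists al be ga : F,
    [/\ al * be * ga != 0, al + be + ga = 0 &
        proj_equiv f (al *: xvar F ^+ q.-1 + be *: yvar F ^+ q.-1
                      + ga *: zvar F ^+ q.-1)].

Definition type_T3 (F : finFieldType) (f : {mpoly F[3]}) : Prop :=
  let q := #|F| in
  let x := xvar F in let y := yvar F in let z := zvar F in
  proj_equiv f (x ^+ q - x * z ^+ q.-1 + x ^+ q.-1 * y - y ^+ q).

(* Geometric notions are required over every algebraically closed extension
   K of F; such K exist (countable_algebraic_closure). *)
Definition component (K : fieldType) (C k : {mpoly K[3]}) : Prop :=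
  mirreducible k /\ exists h : {mpoly K[3]}, C = k * h.

Definition nonlinear (K : fieldType) (k : {mpoly K[3]}) : Prop := (2 < msize k)%N.

(* h is the unique component of degree at least 2 of C. *)
Definition the_nonlinear_component (F : fieldType) (C h : {mpoly F[3]}) : Prop :=
  forall (K : closedFieldType) (iota : {rmorphism F -> K}),
    [/\ component (map_mpoly iota C) (map_mpoly iota h),
        nonlinear (map_mpoly iota h) &
        forall k : {mpoly K[3]}, component (map_mpoly iota C) k ->
          nonlinear k -> same_curve k (map_mpoly iota h)].

Definition nonsingular (F : fieldType) (f : {mpoly F[3]}) : Prop :=
  forall (K : closedFieldType) (iota : {rmorphism F -> K}) (v : 'rV[K]_3),
    v != 0 -> (map_mpoly iota f).@[v 0] = 0 ->
    exists i : 'I_3, (mderiv i (map_mpoly iota f)).@[v 0] != 0.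

(* A row l != 0 stands for the line l_0 x + l_1 y + l_2 z = 0, so lines, too,
   are classes of nonzero vectors. *)
Definition line_form (F : fieldType) (l : 'rV[F]_3) : {mpoly F[3]} :=
  \sum_(i < 3) l 0 i *: 'X_i.

Definition passes_through (F : fieldType) (P l : 'rV[F]_3) : bool :=
  (line_form l).@[P 0] == 0.

Definition lines_through (F : finFieldType) (P : 'rV[F]_3) : {set {set 'rV[F]_3}} :=
  [set ppoint l | l in [set l : 'rV[F]_3 | (l != 0) && passes_through P l]].

(* The curve f = 0 is the sum of the lines in ls, counted with multiplicity. *)
Definition consists_of_lines (F : fieldType) (f : {mpoly F[3]})
    (ls : seq 'rV[F]_3) : Prop :=
  all (fun l => l != 0) ls /\ same_curve f (\prod_(l <- ls) line_form l).

Definition distinct_lines (F : finFieldType) (ls : seq 'rV[F]_3) : bool :=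
  uniq [seq ppoint l | l <- ls].

Definition union_of_all_lines_through (F : finFieldType) (P : 'rV[F]_3)
    (f : {mpoly F[3]}) : Prop :=
  #|lines_through P| = #|F|.+1 /\
  exists ls : seq 'rV[F]_3,
    [/\ consists_of_lines f ls, distinct_lines ls &
        [seq ppoint l | l <- ls] =i lines_through P].

Definition vec3 (F : fieldType) (a b c : F) : 'rV[F]_3 :=
  \row_(i < 3) [:: a; b; c]`_i.

(* Main.v *)
From HB Require Import structures.
Require Import Defs.
From mathcomp Require Import all_boot all_order all_algebra all_field.
From mathcomp Require Import mpoly.
From mathcomp Require Import ring.

(** Put u = (x^q - x z^(q-1), y^q - y z^(q-1)) and let v be the column of x, y
    and z, so that G_M = u M v. Let A be the block matrix of B, b, 0, l. Over the
    field with q elements the Frobenius is additive and fixes scalars, and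
    l^(q-1) = 1; hence the substitution v := A v replaces u by u B^T, and G_N
    becomes G_M with M = B^T N A ([lin_subst_Gpoly]). The theorem is thereby
    reduced to bringing M to a normal form by such operations and scalars
    ([congruent]): the square part M' undergoes a congruence, and the last column
    becomes B^T (M' b + l m).

    The form g is the quadratic form of M', and its zeros are the rational points
    at infinity ([infinity_pzeros]). Two distinct roots, taken as a basis, make
    the diagonal of M' vanish; a double root, taken as the second basis vector,
    leaves a nonzero first diagonal entry and an alternating remainder; if g = 0,
    then M' is alternating. The vector b then clears the last column as far as the
    image of M' permits, and the rank decides whether the rest is zero. The
    normal forms have the equations of the statement.

    The linear pieces come from the identity x^q - x z^(q-1) = prod_c (x - c z)
    ([prod_card_sub]). The nonlinear pieces are irreducible over every extension
    by the Eisenstein criterion. For type T3 the equation is monic in y up to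
    sign, its other coefficients are divisible by x, and the constant one only
    once. For type T2 the constant coefficient in z is a x^(q-1) + b y^(q-1),
    whose linear factors are simple since q - 1 is invertible. As the variables
    are prime, no other irreducible polynomial of degree at least two divides the
    product of such an equation and variables ([nonlinear_factor_same_curve]). *)

Set Implicit Arguments.
Unset Strict Implicit.
Unset Printing Implicit Defensive.

Import GRing.Theory.
Local Open Scope ring_scope.

(** * Coordinates and explicit matrices *)

Notation o20 := (@Ordinal 2 0 isT).
Notation o21 := (@Ordinal 2 1 isT).
Notation o30 := (@Ordinal 3 0 isT).
Notation o31 := (@Ordinal 3 1 isT).
Notation o32 := (@Ordinal 3 2 isT).

Lemma ord2P (P : 'I_2 -> Prop) : P o20 -> P o21 -> forall i, P i.
Proof.
move=> P0 P1 [[|[|m]] lt_m] //.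
- by rewrite (_ : Ordinal lt_m = o20) //; apply: val_inj.
- by rewrite (_ : Ordinal lt_m = o21) //; apply: val_inj.
Qed.

Lemma ord3P (P : 'I_3 -> Prop) : P o30 -> P o31 -> P o32 -> forall i, P i.
Proof.
move=> P0 P1 P2 [[|[|[|m]]] lt_m] //.
- by rewrite (_ : Ordinal lt_m = o30) //; apply: val_inj.
- by rewrite (_ : Ordinal lt_m = o31) //; apply: val_inj.
- by rewrite (_ : Ordinal lt_m = o32) //; apply: val_inj.
Qed.

Lemma ord3_split :
  [/\ o30 = lshift 1 o20, o31 = lshift 1 o21 & o32 = rshift 2 ord0].
Proof. by split; apply: val_inj. Qed.

Lemma sum2E (V : nmodType) (f : 'I_2 -> V) : \sum_i f i = f o20 + f o21.
Proof.
rewrite !big_ord_recl big_ord0 addr0.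
by congr (f _ + f _); apply: val_inj.
Qed.

Lemma sum3E (V : nmodType) (f : 'I_3 -> V) :
  \sum_i f i = f o30 + f o31 + f o32.
Proof.
rewrite !big_ord_recl big_ord0 addr0 addrA.
by congr (f _ + f _ + f _); apply: val_inj.
Qed.

Definition mx23 (R : Type) (a0 a1 a2 b0 b1 b2 : R) : 'M[R]_(2, 3) :=
  \matrix_(i, j) nth a0 (nth [::] [:: [:: a0; a1; a2]; [:: b0; b1; b2]] i) j.

Definition mx22 (R : Type) (a0 a1 b0 b1 : R) : 'M[R]_2 :=
  \matrix_(i, j) nth a0 (nth [::] [:: [:: a0; a1]; [:: b0; b1]] i) j.

Definition col2 (R : Type) (e f : R) : 'cV[R]_2 := \col_i nth e [:: e; f] i.

Definition row2 (R : nzRingType) (s t : R) : 'rV[R]_2 := \row_i [:: s; t]`_i.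

Lemma mx23_eta (R : Type) (M : 'M[R]_(2, 3)) :
  M = mx23 (M o20 o30) (M o20 o31) (M o20 o32)
           (M o21 o30) (M o21 o31) (M o21 o32).
Proof.
by apply/matrixP; elim/ord2P; elim/ord3P; rewrite mxE.
Qed.

Lemma det_mx22 (R : comPzRingType) (a0 a1 b0 b1 : R) :
  \det (mx22 a0 a1 b0 b1) = a0 * b1 - a1 * b0.
Proof.
rewrite (expand_det_row _ o20) sum2E /cofactor !mxE !det_mx11 !mxE /=.
by rewrite expr0 expr1; ring.
Qed.

Lemma unitmx_mx22 (F : fieldType) (r s t u : F) :
  r * u - s * t != 0 -> mx22 r s t u \in unitmx.
Proof. by rewrite unitmxE det_mx22 unitfE. Qed.

Lemma lpart_mx23 (F : fieldType) (a0 a1 a2 b0 b1 b2 : F) :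
  lpart (mx23 a0 a1 a2 b0 b1 b2) = mx22 a0 a1 b0 b1.
Proof. by apply/matrixP; elim/ord2P; elim/ord2P; rewrite !mxE. Qed.

Lemma rV2P (F : Type) (v w : 'rV[F]_2) :
  v 0 o20 = w 0 o20 -> v 0 o21 = w 0 o21 -> v = w.
Proof. by move=> h0 h1; apply/rowP; elim/ord2P. Qed.

Lemma vec3_010 (F : fieldType) : vec3 0 1 0 = delta_mx 0 o31 :> 'rV[F]_3.
Proof. by apply/rowP; elim/ord3P; rewrite !mxE. Qed.

Lemma vec3_001 (F : fieldType) : vec3 0 0 1 = delta_mx 0 o32 :> 'rV[F]_3.
Proof. by apply/rowP; elim/ord3P; rewrite !mxE. Qed.

(** * Frobenius *)

Lemma prednK_card (F : finFieldType) : #|F|.-1.+1 = #|F|.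
Proof. by rewrite prednK // ltnW // finNzRing_gt1. Qed.

Lemma card_finField_pchar (F : finFieldType) :
  {p : nat & {n | p \in [pchar F] & #|F| = (p ^ n)%N}}.
Proof.
have [p _ pF] := finPcharP F.
by exists p; exists (logn p #|F|); rewrite // [LHS](card_pprimeChar pF).
Qed.

Lemma card_finField_eq0 (F : finFieldType) : #|F|%:R = 0 :> F.
Proof.
have [p [n pF q_eq]] := card_finField_pchar F.
have := finNzRing_gt1 F; rewrite q_eq; case: n {q_eq} => // n _.
by rewrite expnS natrM (pcharf0 pF) mul0r.
Qed.

(** The cardinality of F is a power of the characteristic. *)
Lemma mpoly_FrobeniusD (F : finFieldType) (n : nat) (f g : {mpoly F[n]}) :
  (f + g) ^+ #|F| = f ^+ #|F| + g ^+ #|F|.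
Proof.
have [p [k pF q_eq]] := card_finField_pchar F.
apply: exprDn_pchar; rewrite (eq_pnat _ (pchar_lalg _)).
by rewrite (eq_pnat _ (pcharf_eq pF)) q_eq pnatX pnat_id ?(pcharf_prime pF).
Qed.

Lemma mpolyZ_card (F : finFieldType) (n : nat) (c : F) (f : {mpoly F[n]}) :
  (c *: f) ^+ #|F| = c *: f ^+ #|F|.
Proof. by rewrite exprZn expf_card. Qed.

Lemma exprS_card (F : finFieldType) (n : nat) (p : {mpoly F[n]}) :
  p ^+ #|F| = p * p ^+ #|F|.-1.
Proof. by rewrite -exprS prednK_card. Qed.

(** * Substitutions fixing the line at infinity *)

Definition affine_mx (F : fieldType) (B : 'M[F]_2) (b : 'cV[F]_2) (l : F) : 'M[F]_3 :=
  (block_mx B b 0 l%:M : 'M[F]_(2 + 1)).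

(** The right action on coefficient matrices that makes M |-> G_M equivariant,
    by [lin_subst_Gpoly]. *)
Definition affine_act (F : fieldType) (B : 'M[F]_2) (b : 'cV[F]_2) (l : F)
  (M : 'M[F]_(2, 3)) := B^T *m M *m affine_mx B b l.

Lemma affine_mxE (F : fieldType) (r s t u e f l : F) :
  affine_mx (mx22 r s t u) (col2 e f) l =
  \matrix_(i, j) (nth [::] [:: [:: r; s; e]; [:: t; u; f]; [:: 0; 0; l]] i)`_j.
Proof.
have [e0 e1 e2] := ord3_split.
apply/matrixP; elim/ord3P; elim/ord3P; rewrite [RHS]mxE /= ?e0 ?e1 ?e2;
by rewrite [LHS](block_mxEul, block_mxEur, block_mxEdl, block_mxEdr) ?mxE.
Qed.

Lemma affine_act_mx23 (F : fieldType) (r s t u e f l a0 a1 a2 b0 b1 b2 : F) :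
  affine_act (mx22 r s t u) (col2 e f) l (mx23 a0 a1 a2 b0 b1 b2) =
  mx23 (r * (a0 * r + a1 * t) + t * (b0 * r + b1 * t))
       (r * (a0 * s + a1 * u) + t * (b0 * s + b1 * u))
       (r * (a0 * e + a1 * f + a2 * l) + t * (b0 * e + b1 * f + b2 * l))
       (s * (a0 * r + a1 * t) + u * (b0 * r + b1 * t))
       (s * (a0 * s + a1 * u) + u * (b0 * s + b1 * u))
       (s * (a0 * e + a1 * f + a2 * l) + u * (b0 * e + b1 * f + b2 * l)).
Proof.
rewrite /affine_act affine_mxE -mulmxA; apply/matrixP.
elim/ord2P; elim/ord3P;
  by rewrite !mxE sum2E !mxE !sum3E !mxE /= ?mulr0 ?addr0.
Qed.

Lemma Gpoly_mx23 (F : finFieldType) (a0 a1 a2 b0 b1 b2 : F) :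
  let q := #|F| in
  let x := xvar F in let y := yvar F in let z := zvar F in
  Gpoly (mx23 a0 a1 a2 b0 b1 b2) =
  (x ^+ q - x * z ^+ q.-1) * (a0%:MP * x + a1%:MP * y + a2%:MP * z)
  + (y ^+ q - y * z ^+ q.-1) * (b0%:MP * x + b1%:MP * y + b2%:MP * z).
Proof.
move=> q x y z; rewrite /Gpoly -/q -/x -/y -/z -mulmxA.
by rewrite !mxE sum2E !mxE /= !sum3E !mxE.
Qed.

Lemma lin_substXE (F : fieldType) (A : 'M[F]_3) i :
  lin_subst A 'X_i = \sum_j A i j *: 'X_j.
Proof. by rewrite /lin_subst comp_mpolyXU -tnth_nth tnth_mktuple. Qed.

Lemma lin_subst1 (F : fieldType) (f : {mpoly F[3]}) : lin_subst 1%:M f = f.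
Proof.
rewrite /lin_subst -[RHS]comp_mpoly_id; congr (_ \mPo _); apply: eq_mktuple => i.
rewrite (bigD1 i) //= mxE eqxx scale1r big1 ?addr0 // => j ne_ji.
by rewrite mxE eq_sym (negPf ne_ji) scale0r.
Qed.

(** The Frobenius is additive and fixes the entries of the substitution, so the
    row (x^q - x z^(q-1), y^q - y z^(q-1)) is transformed by the linear part B
    alone, without a contribution of the translation b, while (x, y, z) is
    transformed by the whole block matrix. *)
Lemma lin_subst_Gpoly (F : finFieldType) (B : 'M[F]_2) (b : 'cV[F]_2) (l : F)
    (N : 'M[F]_(2, 3)) : l != 0 ->
  lin_subst (affine_mx B b l) (Gpoly N) = Gpoly (affine_act B b l N).
Proof.
move=> nz_l; set A := affine_mx B b l.
have [e0 e1 e2] := ord3_split.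
have A00 : A o32 o30 = 0 by rewrite e0 e2 [LHS]block_mxEdl mxE.
have A01 : A o32 o31 = 0 by rewrite e1 e2 [LHS]block_mxEdl mxE.
have A22 : A o32 o32 = l by rewrite e2 [LHS]block_mxEdr mxE.
have AB (i j : 'I_2) : A (lshift 1 i) (lshift 1 j) = B i j by rewrite [LHS]block_mxEul.
rewrite /affine_act -/A; clearbody A.
pose q := #|F|; pose x := xvar F; pose y := yvar F; pose z := zvar F.
have q1 : q = q.-1.+1 by rewrite prednK // ltnW // finNzRing_gt1.
pose s := [tuple \sum_(j < 3) A i j *: 'X_j | i < 3].
pose sg : {rmorphism {mpoly F[3]} -> {mpoly F[3]}} := comp_mpoly s.
have sgX i : sg 'X_i = A i o30 *: x + A i o31 *: y + A i o32 *: z.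
  exact: etrans (lin_substXE _ _) (sum3E _).
have sgz : sg z = l *: z by rewrite sgX A00 A01 A22 !scale0r !add0r.
(* Nonzero elements of F are (q-1)-st roots of unity, so z^(q-1) is invariant. *)
have l1 : l ^+ q.-1 = 1.
  by apply: (mulfI nz_l); rewrite -exprS -q1 expf_card mulr1.
have sgzq : sg z ^+ q.-1 = z ^+ q.-1 by rewrite sgz exprZn l1 scale1r.
have sgu i : sg ('X_i ^+ q - 'X_i * z ^+ q.-1) =
    A i o30 *: (x ^+ q - x * z ^+ q.-1) + A i o31 *: (y ^+ q - y * z ^+ q.-1).
  rewrite rmorphB rmorphM !rmorphXn /= sgzq sgX !mpoly_FrobeniusD !mpolyZ_card.
  rewrite -/q {3}q1 exprS -!mul_mpolyC; ring.
rewrite /lin_subst -/s -[comp_mpoly s]/(sg : _ -> _) /Gpoly -/q -/x -/y -/z.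
set u := \row_i _; set v := \col_j _.
transitivity ((map_mx sg (u *m map_mx (mpolyC 3 (R:=F)) N *m v)) 0 0).
  by rewrite [RHS]mxE.
rewrite !map_mxM -map_mx_comp.
have -> : map_mx (sg \o mpolyC 3 (R:=F)) N = map_mx (mpolyC 3 (R:=F)) N.
  by apply/matrixP=> i j; rewrite !mxE /= comp_mpolyC.
have -> : map_mx sg u = u *m map_mx (mpolyC 3 (R:=F)) B^T.
  apply/matrixP=> i; elim/ord2P; rewrite !mxE sum2E !mxE /= !(mulrC _ _%:MP);
  rewrite !mul_mpolyC sgu -!AB; congr (A _ _ *: _ + A _ _ *: _); exact: val_inj.
have -> : map_mx sg v = map_mx (mpolyC 3 (R:=F)) A *m v.
  apply/matrixP; elim/ord3P=> j; rewrite !mxE sum3E !mxE /= !mul_mpolyC;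
  exact: sgX.
by rewrite !mulmxA.
Qed.

Lemma GpolyZ (F : finFieldType) (c : F) (M : 'M[F]_(2, 3)) :
  Gpoly (c *: M) = c *: Gpoly M.
Proof.
rewrite /Gpoly; set u := \row_i _; set v := \col_j _.
have -> : map_mx (mpolyC 3 (R:=F)) (c *: M) = c%:MP *: map_mx (mpolyC 3 (R:=F)) M.
  by apply/matrixP=> i j; rewrite !mxE mpolyCM.
by rewrite -scalemxAr -scalemxAl [LHS]mxE mul_mpolyC.
Qed.

(** The scalar c accounts for an equation being determined by its curve only up
    to a scalar; it makes a nonzero diagonal entry equal to 1 even when that entry
    is not a square. *)
Definition congruent (F : fieldType) (M N : 'M[F]_(2, 3)) : Prop :=
  exists (B : 'M[F]_2) (b : 'cV[F]_2) (l c : F),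
    [/\ B \in unitmx, l != 0, c != 0 & M = c *: affine_act B b l N].

(** What reduces the classification of the curves to linear algebra. *)
Lemma congruent_B_equiv (F : finFieldType) (M N : 'M[F]_(2, 3)) :
  congruent M N -> B_equiv (Gpoly M) (Gpoly N).
Proof.
move=> [B [b [l [c [uB nz_l nz_c ->]]]]]; exists B, b, l; split=> //.
exists c^-1; first by rewrite invr_eq0.
by rewrite GpolyZ scalerA mulVf // scale1r; apply: lin_subst_Gpoly.
Qed.

Lemma affine_act_comp (F : fieldType) (B C : 'M[F]_2) (b d : 'cV[F]_2) (l k : F) N :
  affine_act C d k (affine_act B b l N) =
  affine_act (B *m C) (B *m d + k *: b) (l * k) N.
Proof.
rewrite /affine_act trmx_mul !mulmxA -!(mulmxA _ N) -!mulmxA; do 3! congr (_ *m _).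
rewrite /affine_mx; rewrite [LHS](mulmx_block B b 0 l%:M C d 0 k%:M).
rewrite !mulmx0 !mul0mx !addr0 !add0r -scalar_mxM.
by rewrite mul_mx_scalar.
Qed.

Lemma affine_act1 (F : fieldType) (N : 'M[F]_(2, 3)) : affine_act 1%:M 0 1 N = N.
Proof.
rewrite /affine_act /affine_mx trmx1 mul1mx -[RHS]mulmx1; congr (_ *m _).
by rewrite -(scalar_mx_block 2 1 (1 : F)).
Qed.

Lemma affine_actZ (F : fieldType) (B : 'M[F]_2) b (l c : F) N :
  affine_act B b l (c *: N) = c *: affine_act B b l N.
Proof. by rewrite /affine_act -scalemxAr -scalemxAl. Qed.

Lemma congruent_trans (F : fieldType) (N M P : 'M[F]_(2, 3)) :
  congruent M N -> congruent N P -> congruent M P.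
Proof.
move=> [B [b [l [c [uB nz_l nz_c ->]]]]] [C [d [k [e [uC nz_k nz_e ->]]]]].
exists (C *m B), (C *m b + l *: d), (k * l), (c * e).
by split; rewrite ?mulf_neq0 ?unitmx_mul ?uB ?uC // affine_actZ affine_act_comp scalerA.
Qed.

Lemma congruent_sym (F : fieldType) (M N : 'M[F]_(2, 3)) :
  congruent M N -> congruent N M.
Proof.
move=> [B [b [l [c [uB nz_l nz_c ->]]]]].
exists (invmx B), (- (l^-1 *: (invmx B *m b))), l^-1, c^-1.
split; rewrite ?invr_eq0 ?unitmx_inv //.
rewrite affine_actZ scalerA mulVf // scale1r affine_act_comp mulmxV // mulfV // mulmxN.
by rewrite -scalemxAr mulKVmx // addNr affine_act1.
Qed.

Lemma congruent_rank (F : fieldType) (M N : 'M[F]_(2, 3)) :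
  congruent M N -> \rank M = \rank N.
Proof.
move=> [B [b [l [c [uB nz_l nz_c ->]]]]].
rewrite (eqmx_scale _ nz_c) /affine_act mxrankMfree; last first.
  rewrite row_free_unit unitmxE (det_ublock B b) det_scalar1.
  by rewrite unitrM -unitmxE uB unitfE.
by rewrite (eqmxMfull _ _) // row_full_unit unitmx_tr.
Qed.

Lemma lpart_affine_act (F : fieldType) (B : 'M[F]_2) b (l c : F) (N : 'M[F]_(2, 3)) :
  lpart (c *: affine_act B b l N) = c *: (B^T *m lpart N *m B).
Proof.
have lpartZ (X : 'M[F]_(2, 3)) : lpart (c *: X) = c *: lpart X.
  by apply/matrixP => i j; rewrite !mxE.
rewrite lpartZ; congr (_ *: _).
pose N' : 'M[F]_(2, 2 + 1) := N.
transitivity (lsubmx (B^T *m (N' *m block_mx B b 0 l%:M))); first by rewrite mulmxA.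
by rewrite -{1}[N']hsubmxK mul_row_block mul_mx_row row_mxKl mulmx0 addr0 mulmxA.
Qed.

Lemma congruent_det (F : fieldType) (M N : 'M[F]_(2, 3)) :
  congruent M N -> (\det (lpart M) == 0) = (\det (lpart N) == 0).
Proof.
move=> [B [b [l [c [uB nz_l nz_c ->]]]]].
rewrite lpart_affine_act detZ mulf_eq0 expf_eq0 (negPf nz_c).
rewrite !det_mulmx det_tr !mulf_eq0 /=.
by rewrite unitmxE unitfE in uB; rewrite (negPf uB) orbF.
Qed.

(** * Rank of the coefficient matrix *)

Lemma rank_minor (F : fieldType) (X : 'M[F]_(2, 3)) (j k : 'I_3) :
  X o20 j * X o21 k - X o20 k * X o21 j != 0 -> \rank X = 2%N.
Proof.
move=> nz_minor.
pose D : 'M[F]_(3, 2) := \matrix_(i, m) (i == nth j [:: j; k] m)%:R.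
have XD : X *m D = mx22 (X o20 j) (X o20 k) (X o21 j) (X o21 k).
  have XDE r m : (X *m D) r m = X r (nth j [:: j; k] m).
    rewrite mxE (bigD1 (nth j [:: j; k] m)) //= mxE eqxx mulr1 big1 ?addr0 //.
    by move=> i /negPf ne_i; rewrite mxE ne_i mulr0.
  by apply/matrixP; elim/ord2P; elim/ord2P; rewrite XDE mxE.
apply/eqP; rewrite eqn_leq rank_leq_row /=.
apply: leq_trans (mxrankM_maxl X D).
by rewrite mxrank_unit // XD unitmxE unitfE det_mx22.
Qed.

Lemma rank_col_mul_row (F : fieldType) (u : 'cV[F]_2) (w : 'rV[F]_3) :
  (\rank (u *m w) <= 1)%N.
Proof. by rewrite (leq_trans (mxrankM_maxr _ _)) // rank_leq_row. Qed.

Lemma rank_row2_eq0 (F : fieldType) (a b c : F) :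
  (\rank (mx23 a b c 0%R 0%R 0%R) <= 1)%N.
Proof.
have -> : mx23 a b c 0 0 0 = col2 1 0 *m row o20 (mx23 a b c 0 0 0).
  apply/matrixP; elim/ord2P; elim/ord3P;
  by rewrite !mxE big_ord1 !mxE /= ?mul1r ?mul0r.
exact: rank_col_mul_row.
Qed.

Lemma rank_lpart_eq0 (F : fieldType) (c d : F) :
  (\rank (mx23 0%R 0%R c 0%R 0%R d) <= 1)%N.
Proof.
have -> : mx23 0 0 c 0 0 d = col2 c d *m row o20 (mx23 0 0 1 0 0 0).
  apply/matrixP; elim/ord2P; elim/ord3P;
  by rewrite !mxE big_ord1 !mxE /= ?mulr1 ?mulr0.
exact: rank_col_mul_row.
Qed.

(** * Binary quadratic forms and points at infinity *)

Lemma ppoint_eq (F : finFieldType) (n : nat) (v w : 'rV[F]_n) :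
  ppoint v = ppoint w -> exists2 c : F, c != 0 & v = c *: w.
Proof.
move=> eq_vw; have : v \in ppoint w.
  by rewrite -eq_vw; apply/imsetP; exists 1; rewrite ?inE ?oner_neq0 ?scale1r.
by case/imsetP => c; rewrite inE; exists c.
Qed.

Lemma ppointZ (F : finFieldType) (n : nat) (c : F) (v : 'rV[F]_n) :
  c != 0 -> ppoint (c *: v) = ppoint v.
Proof.
move=> nz_c; apply/setP => w; apply/imsetP/imsetP => -[d]; rewrite inE => nz_d ->.
  by exists (d * c); rewrite ?scalerA // inE mulf_neq0.
by exists (d / c); rewrite ?scalerA ?divfK // inE mulf_neq0 ?invr_eq0.
Qed.

Lemma mem_pzeros (F : finFieldType) (n : nat) (f : {mpoly F[n]}) X :
  X \in pzeros f -> exists v : 'rV[F]_n, [/\ v != 0, f.@[v 0] = 0 & X = ppoint v].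
Proof. by case/imsetP => v; rewrite inE => /andP[nz_v /eqP fv] ->; exists v. Qed.

Lemma rV2_proportional (F : fieldType) (v w : 'rV[F]_2) :
  v != 0 -> w != 0 -> v 0 o20 * w 0 o21 - w 0 o20 * v 0 o21 = 0 ->
  exists2 c : F, c != 0 & v = c *: w.
Proof.
move=> nz_v nz_w /eqP; rewrite subr_eq0 => /eqP vw.
suff [c v_eq] : exists c, v = c *: w.
  by exists c => //; apply: contraNneq nz_v => c0; rewrite v_eq c0 scale0r.
have [w0|nz_w0] := eqVneq (w 0 o20) 0.
  have nz_w1 : w 0 o21 != 0.
    by apply: contraNneq nz_w => w1; apply/eqP/rV2P; rewrite ?w0 ?w1 mxE.
  exists (v 0 o21 / w 0 o21); apply: rV2P; rewrite mxE ?divfK // w0 mulr0.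
  by apply: (mulIf nz_w1); rewrite vw w0 !mul0r.
exists (v 0 o20 / w 0 o20); apply: rV2P; rewrite mxE ?divfK //.
by rewrite mulrAC vw mulrAC divff // mul1r.
Qed.

Lemma gpoly_mx22 (F : fieldType) (a0 a1 b0 b1 : F) :
  let s := 'X_o20 in let t := 'X_o21 in
  gpoly (mx22 a0 a1 b0 b1) =
  s * (a0%:MP * s + a1%:MP * t) + t * (b0%:MP * s + b1%:MP * t).
Proof.
move=> s t; rewrite /gpoly -mulmxA.
by rewrite !mxE sum2E !mxE /= !sum2E !mxE.
Qed.

Lemma gpoly_eval (F : fieldType) (a0 a1 b0 b1 : F) (v : 'rV[F]_2) :
  (gpoly (mx22 a0 a1 b0 b1)).@[v 0] =
  a0 * v 0 o20 ^+ 2 + (a1 + b0) * v 0 o20 * v 0 o21 + b1 * v 0 o21 ^+ 2.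
Proof.
rewrite gpoly_mx22 mevalD 2!mevalM 2!mevalD 4!mevalM !mevalC !mevalXU.
by ring.
Qed.

Lemma gpoly_evalZ (F : fieldType) (A : 'M[F]_2) (c : F) (v : 'rV[F]_2) :
  (gpoly A).@[(c *: v) 0] = c ^+ 2 * (gpoly A).@[v 0].
Proof.
have -> : A = mx22 (A o20 o20) (A o20 o21) (A o21 o20) (A o21 o21).
  by apply/matrixP; elim/ord2P; elim/ord2P; rewrite mxE.
by rewrite !gpoly_eval !mxE; ring.
Qed.

Lemma gpoly_eq0 (F : fieldType) (a0 a1 b0 b1 : F) :
  a0 = 0 -> a1 + b0 = 0 -> b1 = 0 -> gpoly (mx22 a0 a1 b0 b1) = 0.
Proof.
move=> -> /eqP; rewrite addrC addr_eq0 => /eqP-> ->; rewrite gpoly_mx22 mpolyCN mpolyC0.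
by ring.
Qed.

(** The values at (1, 0), (0, 1) and (1, 1) determine the three coefficients, so
    a nonzero binary quadratic form is a nonzero function even over F_2. *)
Lemma gpoly_eval_eq0 (F : fieldType) (a0 a1 b0 b1 : F) :
  (forall v : 'rV[F]_2, (gpoly (mx22 a0 a1 b0 b1)).@[v 0] = 0) ->
  [/\ a0 = 0, a1 + b0 = 0 & b1 = 0].
Proof.
move=> g0.
have a00 : a0 = 0.
  have := g0 (row2 1 0); rewrite gpoly_eval !mxE /=.
  by rewrite expr1n expr0n !mulr0 mulr1 !addr0.
have b10 : b1 = 0.
  have := g0 (row2 0 1); rewrite gpoly_eval !mxE /=.
  by rewrite expr1n expr0n !mulr0 mulr1 mul0r !add0r.
split=> //; have := g0 (row2 1 1); rewrite gpoly_eval !mxE /= a00 b10.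
by rewrite !mul0r add0r addr0 !mulr1.
Qed.

(** Since s^q = s in F, the value of G_M at a point (s, t, 0) over F is the value of
    the binary form at (s, t). *)
Lemma infinity_pzeros (F : finFieldType) (M : 'M[F]_(2, 3)) :
  nb_points_at_infinity (Gpoly M) = #|pzeros (gpoly (lpart M))|.
Proof.
rewrite [M]mx23_eta lpart_mx23.
move: (M o20 o30) (M o20 o31) (M o20 o32) (M o21 o30) (M o21 o31) (M o21 o32).
move=> a0 a1 a2 b0 b1 b2 {M}; set g := gpoly _; set G := Gpoly _.
pose e (v : 'rV[F]_2) := vec3 (v 0 o20) (v 0 o21) 0.
have e_inj : injective e.
  by move=> v w /rowP vw; apply: rV2P; [have := vw o30 | have := vw o31]; rewrite !mxE.
have eZ c v : e (c *: v) = c *: e v.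
  by apply/rowP; elim/ord3P; rewrite !mxE /= ?mulr0.
have e_ppoint v : e @: ppoint v = ppoint (e v).
  rewrite /ppoint -imset_comp; apply: eq_imset => c /=; exact: eZ.
have e0 v : (e v == 0) = (v == 0).
  have <- : e 0 = 0 by apply/rowP; elim/ord3P; rewrite !mxE.
  by rewrite (inj_eq e_inj).
have Ge v : G.@[(e v) 0] = g.@[v 0].
  rewrite /G Gpoly_mx23 /g gpoly_eval.
  have q1 : (#|F|.-1 == 0)%N = false.
    by apply/negbTE; rewrite -lt0n -subn1 subn_gt0 finNzRing_gt1.
  rewrite mevalD !mevalM !mevalB !mevalM !rmorphXn /= !mevalD !mevalM !mevalC.
  rewrite !mevalXU !mxE /= !expf_card expr0n q1.
  by rewrite mulr0n; ring.
rewrite -(card_imset _ (@imset_inj _ _ _ e_inj)) /nb_points_at_infinity.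
apply: eq_card => X; apply/setIP/imsetP => [[]|[Y /imsetP[v]]].
  case/imsetP => v; rewrite inE => /andP[nz_v Gv] -> /imsetP[w].
  rewrite inE mevalXU => /andP[_ w0] /ppoint_eq[c _ v_eq].
  pose v' := row2 (v 0 o30) (v 0 o31).
  have v_e : v = e v'.
    apply/rowP; elim/ord3P; rewrite !mxE //= v_eq mxE.
    by rewrite (eqP w0) mulr0.
  exists (ppoint v'); last by rewrite e_ppoint -v_e.
  by rewrite imset_f // inE -e0 -v_e nz_v -Ge -v_e.
rewrite inE => /andP[nz_v gv] -> ->; rewrite e_ppoint; split.
  by rewrite imset_f // inE e0 nz_v Ge.
by rewrite imset_f // inE e0 nz_v mevalXU mxE /= eqxx.
Qed.

Lemma card_pzeros_double_root (F : finFieldType) (g : {mpoly F[2]}) :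
  has_double_root g -> #|pzeros g| = 1%N.
Proof. by move=> [_ [p [_ -> _]]]; rewrite cards1. Qed.

(** At points with z != 0 the factors x^q - x z^(q-1) and y^q - y z^(q-1) vanish,
    at points with z = 0 the quadratic form does. *)
Lemma pzeros_Gpoly_alternating (F : finFieldType) (M : 'M[F]_(2, 3)) :
  gpoly (lpart M) = 0 -> pzeros (Gpoly M) = pspace F 3.
Proof.
rewrite [M]mx23_eta lpart_mx23.
move: (M o20 o30) (M o20 o31) (M o20 o32) (M o21 o30) (M o21 o31) (M o21 o32).
move=> a0 a1 a2 b0 b1 b2 g0.
have [a00 ab0 b10] : [/\ a0 = 0, a1 + b0 = 0 & b1 = 0].
  by apply: gpoly_eval_eq0 => v; rewrite g0 meval0.
rewrite /pzeros /pspace; apply: (congr1 (fun A : {set 'rV[F]_3} => @ppoint F 3 @: A)).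
apply/setP => v; rewrite !inE; case: eqP => //= _; rewrite Gpoly_mx23.
rewrite mevalD !mevalM !mevalB !mevalM !rmorphXn /= !mevalD !mevalM !mevalC.
rewrite !mevalXU !expf_card; apply/eqP.
have [z0|nz_z] := eqVneq (v 0 o32) 0.
  have q1 : (#|F|.-1 == 0)%N = false.
    by apply/negbTE; rewrite -lt0n -subn1 subn_gt0 finNzRing_gt1.
  rewrite z0 expr0n q1 !mulr0n a00 b10.
  have -> : b0 = - a1 by apply/eqP; rewrite -addr_eq0 addrC ab0.
  by ring.
have -> : v 0 o32 ^+ #|F|.-1 = 1.
  by apply: (mulfI nz_z); rewrite -exprS prednK_card expf_card mulr1.
by rewrite !mulr1 !subrr !mul0r addr0.
Qed.

(** * Normal forms of the coefficient matrix *)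

Lemma congruent_swap (F : fieldType) (a0 a1 a2 b0 b1 b2 : F) :
  congruent (mx23 a0 a1 a2 b0 b1 b2) (mx23 b1 b0 b2 a1 a0 a2).
Proof.
exists (mx22 0 1 1 0), (col2 0 0), 1, 1.
split; rewrite ?oner_neq0 //.
  by rewrite unitmxE det_mx22 mul0r mulr1 sub0r unitrN unitr1.
by rewrite scale1r affine_act_mx23; congr mx23; ring.
Qed.

(** Congruence by the matrix with columns p and r puts the values of the form at p
    and r on the diagonal. *)
Lemma congruent_basis (F : fieldType) (M : 'M[F]_(2, 3)) (p r : 'rV[F]_2)
    (g := gpoly (lpart M)) :
  p 0 o20 * r 0 o21 - r 0 o20 * p 0 o21 != 0 -> g != 0 ->
  exists n01 n02 n10 n12 : F,
    [/\ congruent M (mx23 g.@[p 0] n01 n02 n10 g.@[r 0] n12),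
        forall x y, g.@[(x *: p + y *: r) 0] =
          g.@[p 0] * x ^+ 2 + (n01 + n10) * x * y + g.@[r 0] * y ^+ 2
      & [|| g.@[p 0] != 0, n01 + n10 != 0 | g.@[r 0] != 0]].
Proof.
rewrite {}/g [M]mx23_eta lpart_mx23.
move: (M o20 o30) (M o20 o31) (M o20 o32) (M o21 o30) (M o21 o31) (M o21 o32).
move=> a0 a1 a2 b0 b1 b2 {M}; set g := gpoly _ => nz_d nz_g.
set p0 := p 0 o20 in nz_d *; set p1 := p 0 o21 in nz_d *.
set r0 := r 0 o20 in nz_d *; set r1 := r 0 o21 in nz_d *.
pose n01 := p0 * (a0 * r0 + a1 * r1) + p1 * (b0 * r0 + b1 * r1).
pose n10 := r0 * (a0 * p0 + a1 * p1) + r1 * (b0 * p0 + b1 * p1).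
pose n02 := p0 * (a0 * 0 + a1 * 0 + a2 * 1) + p1 * (b0 * 0 + b1 * 0 + b2 * 1).
pose n12 := r0 * (a0 * 0 + a1 * 0 + a2 * 1) + r1 * (b0 * 0 + b1 * 0 + b2 * 1).
have gE x y : g.@[(x *: p + y *: r) 0] =
          g.@[p 0] * x ^+ 2 + (n01 + n10) * x * y + g.@[r 0] * y ^+ 2.
  rewrite !gpoly_eval !mxE -/p0 -/p1 -/r0 -/r1 /n01 /n10; ring.
exists n01, n02, n10, n12; split=> //.
  apply: congruent_sym; exists (mx22 p0 r0 p1 r1), (col2 0 0), 1, 1.
  split; rewrite ?oner_neq0 ?unitmxE ?unitfE ?det_mx22 //.
  rewrite scale1r affine_act_mx23 !gpoly_eval -/p0 -/p1 -/r0 -/r1.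
  by congr mx23; ring.
rewrite -!negb_and; apply: contra nz_g => /and3P[/eqP gp /eqP n0 /eqP gr].
suff g0 (v : 'rV[F]_2) : g.@[v 0] = 0.
  by have [a00 ab0 b10] := gpoly_eval_eq0 g0; rewrite /g gpoly_eq0.
(* Cramer's formulas for the coordinates of v in the basis (p, r). *)
pose d := p0 * r1 - r0 * p1.
pose x := (v 0 o20 * r1 - r0 * v 0 o21) / d.
pose y := (p0 * v 0 o21 - v 0 o20 * p1) / d.
have -> : v = x *: p + y *: r.
  apply: rV2P; rewrite !mxE -/p0 -/p1 -/r0 -/r1 /x /y /d; field; exact: nz_d.
by rewrite gE gp n0 gr !mul0r !addr0.
Qed.

(** A basis made of the two roots makes the diagonal vanish. *)
Lemma two_roots_normal_form (F : finFieldType) (M : 'M[F]_(2, 3)) :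
  has_two_distinct_roots (gpoly (lpart M)) ->
  exists a a2 b b2 : F, congruent M (mx23 0 a a2 b 0 b2) /\ a + b != 0.
Proof.
move=> [nz_g /eqP/cards2P[X [Y [neXY gXY]]]].
have [|v [nz_v gv X_eq]] := @mem_pzeros _ _ (gpoly (lpart M)) X.
  by rewrite gXY !inE eqxx.
have [|w [nz_w gw Y_eq]] := @mem_pzeros _ _ (gpoly (lpart M)) Y.
  by rewrite gXY !inE eqxx orbT.
have nz_d : v 0 o20 * w 0 o21 - w 0 o20 * v 0 o21 != 0.
  apply: contraNneq neXY => /(rV2_proportional nz_v nz_w)[c nz_c v_eq].
  by rewrite X_eq Y_eq v_eq ppointZ.
have [a [a2 [b [b2 []]]]] := congruent_basis nz_d nz_g.
rewrite gv gw eqxx orbF /= => MN _ nz_ab.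
by exists a, a2, b, b2.
Qed.

(** The determinant of a matrix with zero diagonal vanishes only with one of the
    two other entries; exchanging the basis vectors decides which one. *)
Lemma two_roots_one_entry (F : fieldType) (M : 'M[F]_(2, 3)) (a a2 b b2 : F) :
  congruent M (mx23 0 a a2 b 0 b2) -> a + b != 0 -> \det (lpart M) = 0 ->
  exists c c2 d2 : F, congruent M (mx23 0 c c2 0 0 d2) /\ c != 0.
Proof.
move=> MN nz_ab /eqP; rewrite (congruent_det MN) lpart_mx23 det_mx22.
rewrite mul0r sub0r oppr_eq0 mulf_eq0 => /orP[/eqP a0|/eqP b0].
  exists b, b2, a2; rewrite a0 add0r in nz_ab MN; split=> //.
  exact: congruent_trans MN (congruent_swap _ _ _ _ _ _).
by exists a, a2, b2; rewrite b0 addr0 in nz_ab MN.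
Qed.

(** A basis whose second vector is the root. *)
Lemma double_root_normal_form (F : finFieldType) (M : 'M[F]_(2, 3)) :
  has_double_root (gpoly (lpart M)) ->
  exists a e a2 b2 : F, congruent M (mx23 a e a2 (- e) 0 b2) /\ a != 0.
Proof.
set g := gpoly _ => -[nz_g [r [nz_r g_r _]]].
have gr : g.@[r 0] = 0.
  have [|v [nz_v gv]] := @mem_pzeros _ _ g (ppoint r); first by rewrite g_r set11.
  by case/ppoint_eq => c nz_c ->; rewrite gpoly_evalZ gv mulr0.
pose p : 'rV[F]_2 := if r 0 o21 == 0 then row2 0 1 else row2 1 0.
have nz_d : p 0 o20 * r 0 o21 - r 0 o20 * p 0 o21 != 0.
  rewrite /p; have [r1|nz_r1] := eqVneq (r 0 o21) 0; rewrite !mxE /=.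
    rewrite mul0r sub0r mulr1 oppr_eq0; apply: contraNneq nz_r => r0.
    by apply/eqP/rV2P; rewrite ?r0 ?r1 mxE.
  by rewrite mul1r mulr0 subr0.
have [a [a2 [b [b2 []]]]] := congruent_basis nz_d nz_g.
rewrite gr eqxx orbF => MN gE nz.
(* Otherwise X (g(p) X + (a + b) Y), the form in the basis (p, r), has a root
   besides r. *)
have ab0 : a + b = 0.
  apply/eqP; apply: contraTT isT => nz_ab.
  pose w := (a + b) *: p + (- g.@[p 0]) *: r.
  have gw : g.@[w 0] = 0 by rewrite gE; ring.
  have nz_dw : w 0 o20 * r 0 o21 - r 0 o20 * w 0 o21 != 0.
    have -> : w 0 o20 * r 0 o21 - r 0 o20 * w 0 o21 =
       (a + b) * (p 0 o20 * r 0 o21 - r 0 o20 * p 0 o21) by rewrite !mxE; ring.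
    exact: mulf_neq0.
  have nz_w : w != 0.
    by apply: contraNneq nz_dw => ->; rewrite !mxE mul0r mulr0 subrr.
  have : ppoint w \in pzeros g by rewrite imset_f // inE nz_w gw eqxx.
  rewrite g_r inE => /eqP/ppoint_eq[c _ w_eq]; case/negP: nz_dw.
  by rewrite w_eq !mxE; apply/eqP; ring.
have b_eq : b = - a by apply/eqP; rewrite -addr_eq0 addrC ab0.
exists g.@[p 0], a, a2, b2; rewrite b_eq in MN; split=> //.
by move: nz; rewrite ab0 eqxx orbF.
Qed.

Lemma zero_gpoly_form (F : fieldType) (M : 'M[F]_(2, 3)) :
  gpoly (lpart M) = 0 -> exists e a2 b2, M = mx23 0 e a2 (- e) 0 b2.
Proof.
rewrite [M]mx23_eta lpart_mx23.
move: (M o20 o30) (M o20 o31) (M o20 o32) (M o21 o30) (M o21 o31) (M o21 o32).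
move=> a0 a1 a2 b0 b1 b2 g0.
have [-> ab0 ->] : [/\ a0 = 0, a1 + b0 = 0 & b1 = 0].
  by apply: gpoly_eval_eq0 => v; rewrite g0 meval0.
exists a1, a2, b2; congr mx23.
by apply/eqP; rewrite -addr_eq0 addrC ab0.
Qed.

(** In this lemma and those that follow, b solves the equations that clear the last
    column as far as the square part allows, and B, l, c rescale what is left. *)
Lemma congruent_antidiag (F : fieldType) (a a2 b b2 : F) :
  a != 0 -> b != 0 -> congruent (mx23 0 a a2 b 0 b2) (mx23 0 a 0 b 0 0).
Proof.
move=> nz_a nz_b; exists (mx22 1 0 0 1), (col2 (b2 / b) (a2 / a)), 1, 1.
split; rewrite ?oner_neq0 ?unitmx_mx22 ?mulr1 ?mulr0 ?subr0 ?oner_neq0 //.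
by rewrite scale1r affine_act_mx23; congr mx23; field; rewrite ?nz_a ?nz_b.
Qed.

Lemma congruent_nilpotent_rank2 (F : fieldType) (a a2 b2 : F) :
  a != 0 -> b2 != 0 -> congruent (mx23 0 a a2 0 0 b2) (mx23 0 1 0 0 0 1).
Proof.
move=> nz_a nz_b; exists (mx22 a 0 0 1), (col2 0 (a2 / a)), b2, 1.
split; rewrite ?oner_neq0 ?unitmx_mx22 ?mulr1 ?mulr0 ?subr0 ?oner_neq0 //.
by rewrite scale1r affine_act_mx23; congr mx23; field; rewrite ?nz_a ?nz_b.
Qed.

Lemma congruent_nilpotent_rank1 (F : fieldType) (a a2 : F) :
  a != 0 -> congruent (mx23 0 a a2 0 0 0) (mx23 0 1 0 0 0 0).
Proof.
move=> nz_a; exists (mx22 a 0 0 1), (col2 0 (a2 / a)), 1, 1.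
split; rewrite ?oner_neq0 ?unitmx_mx22 ?mulr1 ?mulr0 ?subr0 ?oner_neq0 //.
by rewrite scale1r affine_act_mx23; congr mx23; field; rewrite ?nz_a.
Qed.

Lemma congruent_invertible_double (F : fieldType) (a e a2 b2 : F) :
  a != 0 -> e != 0 ->
  congruent (mx23 a e a2 (- e) 0 b2) (mx23 1 1 0 (-1) 0 0).
Proof.
move=> nz_a nz_e.
exists (mx22 1 0 0 (e / a)), (col2 (- b2 / e) (a2 / a + b2 / e)), 1, a.
split; rewrite ?oner_neq0 //.
  by rewrite unitmx_mx22 // mul1r mulr0 subr0 mulf_neq0 ?invr_eq0.
rewrite affine_act_mx23; apply/matrixP; elim/ord2P; elim/ord3P;
by rewrite !mxE /=; field; rewrite ?nz_a ?nz_e.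
Qed.

Lemma congruent_square_rank2 (F : fieldType) (a a2 b2 : F) :
  a != 0 -> b2 != 0 -> congruent (mx23 a 0 a2 0 0 b2) (mx23 1 0 0 0 0 1).
Proof.
move=> nz_a nz_b; exists (mx22 1 0 0 1), (col2 (a2 / a) 0), (b2 / a), a.
split; rewrite ?mulf_neq0 ?invr_eq0 ?unitmx_mx22 ?mulr1 ?mulr0 ?subr0 ?oner_neq0 //.
rewrite affine_act_mx23; apply/matrixP; elim/ord2P; elim/ord3P;
by rewrite !mxE /=; field; rewrite ?nz_a ?nz_b.
Qed.

Lemma congruent_square_rank1 (F : fieldType) (a a2 : F) :
  a != 0 -> congruent (mx23 a 0 a2 0 0 0) (mx23 1 0 0 0 0 0).
Proof.
move=> nz_a; exists (mx22 1 0 0 1), (col2 (a2 / a) 0), 1, a.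
split; rewrite ?unitmx_mx22 ?mulr1 ?mulr0 ?subr0 ?oner_neq0 //.
rewrite affine_act_mx23; apply/matrixP; elim/ord2P; elim/ord3P;
by rewrite !mxE /=; field; rewrite ?nz_a.
Qed.

Lemma congruent_alternating (F : fieldType) (e a2 b2 : F) :
  e != 0 -> congruent (mx23 0 e a2 (- e) 0 b2) (mx23 0 1 0 (-1) 0 0).
Proof.
move=> nz_e; exists (mx22 1 0 0 1), (col2 (- b2 / e) (a2 / e)), 1, e.
split; rewrite ?unitmx_mx22 ?mulr1 ?mulr0 ?subr0 ?oner_neq0 //.
rewrite affine_act_mx23; apply/matrixP; elim/ord2P; elim/ord3P;
by rewrite !mxE /=; field; rewrite ?nz_e.
Qed.

(** Here the square part is zero, so that B^T acts linearly on the last column and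
    maps (1, 0) to the first row of B. *)
Lemma congruent_last_column (F : fieldType) (a2 b2 : F) :
  (a2 != 0) || (b2 != 0) ->
  congruent (mx23 0 0 a2 0 0 b2) (mx23 0 0 1 0 0 0).
Proof.
have [a20 nz_b2|nz_a2 _] := eqVneq a2 0.
  exists (mx22 a2 b2 1 0), (col2 0 0), 1, 1.
  split; rewrite ?oner_neq0 // ?unitmx_mx22 ?a20 ?mul0r ?mulr1 ?sub0r ?oppr_eq0 //.
  by rewrite scale1r affine_act_mx23; congr mx23; ring.
exists (mx22 a2 b2 0 1), (col2 0 0), 1, 1.
split; rewrite ?oner_neq0 // ?unitmx_mx22 ?mulr0 ?mulr1 ?subr0 //.
by rewrite scale1r affine_act_mx23; congr mx23; ring.
Qed.

(** * Irreducibility by the Eisenstein criterion *)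

(** At the origin one of the two factors vanishes; if it is not p, then a factor
    X can be removed from r. *)
Lemma coef0_factor_of_monomial (R : idomainType) (p r : {poly R}) (c : R) n :
  c != 0 -> p * r = c *: 'X^n -> (1 < size p)%N -> p`_0 = 0.
Proof.
move=> nz_c; elim: n => [|n IHn] in r *.
  rewrite expr0 alg_polyC => pr_c sz_p.
  have nz_pr : p * r != 0 by rewrite pr_c polyC_eq0.
  have /andP[nz_p nz_r] : (p != 0) && (r != 0) by rewrite -negb_or -mulf_eq0.
  have := size_mul nz_p nz_r; rewrite pr_c size_polyC nz_c.
  rewrite -size_poly_gt0 in nz_r.
  move: (size p) (size r) sz_p nz_r => [|[|k]] [|m] //= _ _.
  by rewrite addnS.
move=> pr_c sz_p; have [//|nz_p0] := eqVneq p`_0 0.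
have /eqP : (p * r)`_0 = 0 by rewrite pr_c coefZ coefXn mulr0.
rewrite coef0M mulf_eq0 (negPf nz_p0) -horner_coef0 => /factor_theorem[r' r_eq].
apply: (IHn r') => //; apply: (mulIf (negbT (polyX_eq0 R))).
by rewrite -mulrA -scalerAl -exprSr -pr_c r_eq subr0.
Qed.

(** Eisenstein's criterion for the prime Y - s of S[Y]. Reduction modulo that
    prime is evaluation at s, and the hypothesis on the derivative says that the
    constant coefficient is not divisible by the square of the prime: a product of
    two elements vanishing at s has a derivative vanishing at s. *)
Lemma eisenstein (S : idomainType) (s : S) (f a b : {poly {poly S}}) :
  f = a * b -> lead_coef f \is a GRing.unit ->
  (forall i, (i < (size f).-1)%N -> (f`_i).[s] = 0) ->
  (f`_0)^`().[s] != 0 ->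
  a \is a GRing.unit \/ b \is a GRing.unit.
Proof.
move=> f_eq uf f_mod df.
have := uf; rewrite f_eq lead_coefM unitrM => /andP[ua ub].
pose ev := map_poly (horner_eval s).
have unit_ev (t : {poly S}) : t \is a GRing.unit -> t.[s] != 0.
  by rewrite poly_unitE => /andP[/size_poly1P[c nz_c ->] _]; rewrite hornerC.
have size_ev (t : {poly {poly S}}) :
    lead_coef t \is a GRing.unit -> size (ev t) = size t.
  by move=> ut; apply: size_map_poly_id0; apply: unit_ev.
have ev_f : ev a * ev b = (lead_coef f).[s] *: 'X^((size f).-1).
  rewrite -rmorphM -f_eq; apply/polyP=> i.
  rewrite coef_map coefZ coefXn /=; case: (ltngtP i (size f).-1) => [lt_i|gt_i|->].
  - by rewrite mulr0; apply: f_mod.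
  - rewrite mulr0 nth_default; first exact: horner0.
    by move: (size f) gt_i => [|m].
  - by rewrite mulr1 lead_coefE.
have small (t : {poly {poly S}}) :
    lead_coef t \is a GRing.unit -> (size t <= 1)%N -> t \is a GRing.unit.
  move=> ut sz_t; rewrite poly_unitE.
  have nz_t : t != 0 by apply: contraTneq ut => ->; rewrite lead_coef0 unitr0.
  have sz1 : size t = 1%N by apply/eqP; rewrite eqn_leq sz_t size_poly_gt0.
  by rewrite sz1 eqxx; move: ut; rewrite lead_coefE sz1.
have [/(small _ ua)|sz_a] := leqP (size a) 1; first by left.
have [/(small _ ub)|sz_b] := leqP (size b) 1; first by right.
case/negP: df; rewrite f_eq coef0M derivM hornerD !hornerM.
have a0 : (a`_0).[s] = 0.
  have := coef0_factor_of_monomial (unit_ev _ uf) ev_f; rewrite coef_map size_ev //.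
  exact.
have b0 : (b`_0).[s] = 0.
  rewrite mulrC in ev_f.
  have := coef0_factor_of_monomial (unit_ev _ uf) ev_f; rewrite coef_map size_ev //.
  exact.
by rewrite a0 b0 mulr0 mul0r addr0.
Qed.

(** The shape taken by each of the three nonlinear curves when one variable is
    singled out. *)
Lemma eisenstein_trinomial (S : idomainType) (s u : S) (A B : {poly S}) (n : nat)
    (a b : {poly {poly S}}) :
  (1 < n)%N -> u \is a GRing.unit -> A.[s] = 0 -> B.[s] = 0 -> B^`().[s] != 0 ->
  u%:P *: 'X^n + A *: 'X + B%:P = a * b ->
  a \is a GRing.unit \/ b \is a GRing.unit.
Proof.
move=> n_gt1 uu As Bs dBs f_ab; set f := _ + _ + _ in f_ab.
have n_gt0 := ltnW n_gt1.
have fE i : f`_i = u%:P *+ (i == n) + A *+ (i == 1%N) + B *+ (i == 0%N).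
  rewrite !coefD !coefZ coefXn coefX coefC !mulr_natr.
  by case: (i == 0%N).
have nz_u : u%:P != 0 by rewrite polyC_eq0; apply: contraTneq uu => ->; rewrite unitr0.
have sz_f : size f = n.+1.
  rewrite /f -addrA size_polyDl size_scale ?size_polyXn //.
  rewrite (leq_ltn_trans (size_polyD _ _)) // ltnS geq_max.
  rewrite (leq_trans (size_scale_leq _ _)) ?size_polyX //=.
  by rewrite (leq_trans (size_polyC_leq1 _)).
apply: (eisenstein (s := s) f_ab).
- rewrite lead_coefE sz_f fE eqxx !gtn_eqF // !mulr0n !addr0 /=.
  exact: rmorph_unit.
- move=> i; rewrite sz_f fE /= => lt_in.
  by rewrite (ltn_eqF lt_in) mulr0n add0r hornerD !hornerMn As Bs !mul0rn addr0.
- by rewrite fE ltn_eqF // !mulr0n !add0r.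
Qed.

Definition tower_var (K : fieldType) (i0 i1 i : 'I_3) : {poly {poly {poly K}}} :=
  if i == i0 then 'X else if i == i1 then 'X%:P else 'X%:P%:P.

(** The ring K[x, y, z] as iterated univariate polynomials, outermost variable
    i0, then i1. The order is a parameter because each curve needs its own choice
    for Eisenstein's criterion to apply. *)
Definition tower (K : fieldType) (i0 i1 : 'I_3) (p : {mpoly K[3]}) :
    {poly {poly {poly K}}} :=
  mmap (polyC \o (polyC \o polyC)) (tower_var K i0 i1) p.

HB.instance Definition _ (K : fieldType) (i0 i1 : 'I_3) :=
  GRing.RMorphism.copy (@tower K i0 i1)
    (mmap (polyC \o (polyC \o polyC)) (tower_var K i0 i1)).

Lemma towerX (K : fieldType) (i0 i1 i : 'I_3) :
  tower i0 i1 'X_i = tower_var K i0 i1 i.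
Proof. by rewrite [LHS]mmapX mmap1U. Qed.

(** Evaluating the iterated polynomials at the three variables is a left inverse
    of [tower], and ring morphisms preserve units. *)
Lemma tower_unit (K : fieldType) (i0 i1 i2 : 'I_3) (p : {mpoly K[3]}) :
  (forall i, i \in [:: i0; i1; i2]) ->
  tower i0 i1 p \is a GRing.unit -> (msize p <= 1)%N.
Proof.
move=> cover up.
pose untower1 : {rmorphism {poly K} -> {mpoly K[3]}} :=
  horner_morph (fun c => mulrC 'X_i2 (@mpolyC 3 K c)).
pose untower2 : {rmorphism {poly {poly K}} -> {mpoly K[3]}} :=
  horner_morph (fun c => mulrC 'X_i1 (untower1 c)).
pose untower : {rmorphism {poly {poly {poly K}}} -> {mpoly K[3]}} :=
  horner_morph (fun c => mulrC 'X_i0 (untower2 c)).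
have u1X : untower1 'X = 'X_i2 by exact: horner_morphX.
have u2X : untower2 'X = 'X_i1 by exact: horner_morphX.
have u0X : untower 'X = 'X_i0 by exact: horner_morphX.
have u1C c : untower1 c%:P = c%:MP by exact: horner_morphC.
have u2C c : untower2 c%:P = untower1 c by exact: horner_morphC.
have u0C c : untower c%:P = untower2 c by exact: horner_morphC.
have untowerX i : untower (tower_var K i0 i1 i) = 'X_i.
  rewrite /tower_var; have := cover i; rewrite !inE.
  case: eqP => [->|_]; first by rewrite u0X.
  case: eqP => [->|_ /= /eqP->]; first by rewrite u0C u2X.
  by rewrite u0C u2C u1X.
have towerK : untower (tower i0 i1 p) = p.
  rewrite /tower /mmap rmorph_sum [RHS]mpolyE; apply: eq_bigr => m _.
  rewrite rmorphM (etrans (u0C _) (etrans (u2C _) (u1C _))) mul_mpolyC.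
  congr (_ *: _); rewrite /mmap1 rmorph_prod mpolyXE_id.
  by apply: eq_bigr => i _; rewrite rmorphXn untowerX.
have : p \is a GRing.unit by rewrite -towerK rmorph_unit.
by rewrite qualifE /= => /andP[/eqP-> _]; rewrite msizeC; case: (_ != _).
Qed.

(** The innermost ring K[x_i2] is presented as an abstract domain S: irreducibility
    proofs only need the images of the constants and of the variables. *)
Lemma tower_exists (K : fieldType) (i0 i1 i2 : 'I_3) :
  uniq [:: i0; i1; i2] ->
  exists (S : idomainType) (kappa : {rmorphism K -> S}) (t : S)
         (phi : {rmorphism {mpoly K[3]} -> {poly {poly S}}}),
    [/\ t != 0, forall c, phi c%:MP = (kappa c)%:P%:P,
        [/\ phi 'X_i0 = 'X, phi 'X_i1 = 'X%:P & phi 'X_i2 = t%:P%:P]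
      & forall p, phi p \is a GRing.unit -> (msize p <= 1)%N].
Proof.
move=> u012; exists {poly K}, polyC, 'X, (@tower K i0 i1).
split; first by rewrite polyX_eq0.
- by move=> c; rewrite [LHS]mmapC.
- move: u012; rewrite /= !inE negb_or andbT => /andP[/andP[n01 n02] n12].
  rewrite !towerX /tower_var !eqxx (eq_sym i1) !(eq_sym i2).
  by rewrite (negPf n01) (negPf n02) (negPf n12).
- move=> p; apply: (@tower_unit _ _ _ i2) => i.
  have [_ cov] := uniq_min_size u012 (fun n _ => mem_enum 'I_3 n)
                                (eq_leq (size_enum_ord 3)).
  by rewrite cov mem_enum.
Qed.

Lemma mirreducible_trinomial (K : fieldType) (S : idomainType)
    (phi : {rmorphism {mpoly K[3]} -> {poly {poly S}}}) (h : {mpoly K[3]})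
    (n : nat) (s u : S) (A B : {poly S}) :
  (forall p, phi p \is a GRing.unit -> (msize p <= 1)%N) ->
  phi h = u%:P *: 'X^n + A *: 'X + B%:P ->
  (1 < n)%N -> u \is a GRing.unit -> A.[s] = 0 -> B.[s] = 0 -> B^`().[s] != 0 ->
  (1 < msize h)%N -> mirreducible h.
Proof.
move=> unit_phi h_eq n_gt1 uu As Bs dBs h_gt1; split=> // a b ab.
have f_ab : u%:P *: 'X^n + A *: 'X + B%:P = phi a * phi b.
  by rewrite -h_eq ab rmorphM.
by case: (eisenstein_trinomial n_gt1 uu As Bs dBs f_ab) => /unit_phi;
  [left | right].
Qed.

(** * Removing coordinate lines *)

(** Reduction modulo the variable i. *)
Definition set_var0 (K : fieldType) (i : 'I_3) (p : {mpoly K[3]}) : {mpoly K[3]} :=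
  p \mPo [tuple if j == i then 0 else 'X_j | j < 3].

(** It suffices to consider a monomial, which is fixed or divisible by the variable. *)
Lemma set_var0P (K : fieldType) (i : 'I_3) (p : {mpoly K[3]}) :
  exists r, p = set_var0 i p + 'X_i * r.
Proof.
pose r (m : 'X_{1..3}) : {mpoly K[3]} := if m i == 0%N then 0 else 'X_[m - U_(i)].
have monom (m : 'X_{1..3}) : 'X_[m] = set_var0 i 'X_[m] + 'X_i * r m.
  rewrite /r /set_var0 comp_mpolyX; case: eqP => [mi0|/eqP mi_gt0].
    rewrite mulr0 addr0 mpolyXE_id; apply: eq_bigr => j _.
    by rewrite tnth_mktuple; case: eqP => // ->; rewrite mi0.
  rewrite (bigD1 i) //= tnth_mktuple eqxx expr0n (negPf mi_gt0) mul0r add0r.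
  rewrite -mpolyXD addmC submK //; apply/mnm_lepP => j; rewrite mnm1E.
  by case: eqP => // <-; rewrite lt0n.
exists (\sum_(m <- msupp p) p@_m *: r m).
rewrite {1 2}[p]mpolyE /set_var0 raddf_sum mulr_sumr -big_split /=.
by apply: eq_bigr => m _; rewrite comp_mpolyZ -scalerAr -scalerDr -monom.
Qed.

(** A variable is prime: it generates the kernel of a morphism to an integral
    domain. *)
Lemma dvd_var_mul (K : fieldType) (i : 'I_3) (p k e : {mpoly K[3]}) :
  'X_i * p = k * e ->
  (exists r, k = 'X_i * r) \/ (exists r, e = 'X_i * r).
Proof.
move=> eq_ke.
have : set_var0 i k * set_var0 i e = 0.
  rewrite -[_ * _](rmorphM (comp_mpoly _)) -eq_ke rmorphM /= comp_mpolyXU.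
  by rewrite -tnth_nth tnth_mktuple eqxx mul0r.
move/eqP; rewrite mulf_eq0 => /orP[]/eqP set0; [left|right].
- by have [r ->] := set_var0P i k; exists r; rewrite set0 add0r.
- by have [r ->] := set_var0P i e; exists r; rewrite set0 add0r.
Qed.

Lemma same_curve_refl (F : fieldType) (f : {mpoly F[3]}) : same_curve f f.
Proof. by exists 1; rewrite ?oner_neq0 ?scale1r. Qed.

(** A nonlinear irreducible factor is not divisible by a variable, so the primes
    X_i can be cancelled one after the other until a factor of h is left. *)
Lemma nonlinear_factor_same_curve (K : fieldType) (s : seq 'I_3)
    (h k e : {mpoly K[3]}) :
  mirreducible h -> mirreducible k -> nonlinear k ->
  (\prod_(i <- s) 'X_i) * h = k * e -> same_curve k h.
Proof.
move=> [h_gt1 irr_h] irr_k nl_k; elim: s e => [|i s IHs] e.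
  rewrite big_nil mul1r => h_ke.
  case: (irr_h _ _ h_ke) => [|/msize1_polyC e_c].
    by case: irr_k => k_gt1 _; rewrite leqNgt k_gt1.
  exists (e@_0)^-1; last first.
    rewrite h_ke e_c mulrC mul_mpolyC scalerA mcoeffC eqxx mulr1.
    rewrite mulVf ?scale1r //.
    by apply: contraTneq h_gt1 => e0; rewrite h_ke e_c e0 mpolyC0 mulr0 msize0.
  rewrite invr_eq0; apply: contraTneq h_gt1 => e0.
  by rewrite h_ke e_c e0 mpolyC0 mulr0 msize0.
rewrite big_cons -mulrA => eq_ke.
have nzX : 'X_i != 0 :> {mpoly K[3]} by rewrite -msize_poly_eq0 msizeX.
have [[r k_eq]|[r e_eq]] := dvd_var_mul eq_ke.
  case: irr_k => k_gt1 /(_ _ _ k_eq); rewrite msizeX mdeg1 => -[]//.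
  move/msize1_polyC => r_c; move: nl_k; rewrite /nonlinear k_eq r_c mulrC mul_mpolyC.
  by rewrite ltnNge (leq_trans (msizeZ_le _ _)) // msizeX mdeg1.
by apply: (IHs r); apply: (mulfI nzX); rewrite eq_ke e_eq mulrCA.
Qed.

Lemma the_nonlinear_component_mulX (F : fieldType) (s : seq 'I_3)
    (h : {mpoly F[3]}) :
  (forall (K : closedFieldType) (iota : {rmorphism F -> K}),
     mirreducible (map_mpoly iota h)) ->
  (2 < msize h)%N ->
  the_nonlinear_component ((\prod_(i <- s) 'X_i) * h) h.
Proof.
move=> irr_h h_gt2 K iota.
have map_C : map_mpoly iota ((\prod_(i <- s) 'X_i) * h)
    = (\prod_(i <- s) 'X_i) * map_mpoly iota h.
  rewrite rmorphM rmorph_prod /=; congr (_ * _).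
  by apply: eq_bigr => i _; rewrite map_mpolyX.
split.
- by split=> //; exists (\prod_(i <- s) 'X_i); rewrite map_C mulrC.
- rewrite /nonlinear /mmeasure (perm_big _ (msupp_map_mpoly _ (fmorph_inj iota))).
  exact: h_gt2.
- move=> k [irr_k [e C_ke]] nl_k.
  apply: (nonlinear_factor_same_curve (s := s) (e := e)) => //.
  by rewrite -map_C.
Qed.

(** * Curves of types T2 and T3 *)

Lemma map_xvar (F K : fieldType) (iota : {rmorphism F -> K}) :
  map_mpoly iota (xvar F) = xvar K.
Proof. exact: map_mpolyX. Qed.

Lemma map_yvar (F K : fieldType) (iota : {rmorphism F -> K}) :
  map_mpoly iota (yvar F) = yvar K.
Proof. exact: map_mpolyX. Qed.

Lemma map_zvar (F K : fieldType) (iota : {rmorphism F -> K}) :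
  map_mpoly iota (zvar F) = zvar K.
Proof. exact: map_mpolyX. Qed.

Lemma dhomog_msizeS (K : fieldType) (n d : nat) (p : {mpoly K[n]}) :
  p != 0 -> p \is d.-homog -> msize p = d.+1.
Proof. by move=> nz_p /dhomogP/(_ _ (mlead_supp nz_p)) <-; rewrite mlead_deg. Qed.

Lemma homogX (K : fieldType) (n d : nat) (i : 'I_n) :
  ('X_i ^+ d : {mpoly K[n]}) \is d.-homog.
Proof. by rewrite -{2}[d]mul1n; apply: dhomogMn; rewrite dhomogX; apply/eqP/mdeg1. Qed.

Lemma homogXMX (K : fieldType) (n d : nat) (i j : 'I_n) :
  (0 < d)%N -> ('X_i * 'X_j ^+ d.-1 : {mpoly K[n]}) \is d.-homog.
Proof.
case: d => // d _; rewrite -[d.+1]add1n; apply: dhomogM; last exact: homogX.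
by have := homogX K 1 i; rewrite expr1.
Qed.

Lemma nonzero_of_eval (K : fieldType) n (v : 'I_n -> K) (p : {mpoly K[n]}) :
  p.@[v] != 0 -> p != 0.
Proof. by apply: contraNneq => ->; rewrite meval0. Qed.

Definition T3_curve (K : fieldType) (q : nat) : {mpoly K[3]} :=
  xvar K ^+ q - xvar K * zvar K ^+ q.-1 + yvar K * xvar K ^+ q.-1 - yvar K ^+ q.

(** Another member of the class of [T3_curve], see [T3_twist_type_T3]. *)
Definition T3_twist (K : fieldType) (q : nat) : {mpoly K[3]} :=
  xvar K ^+ q - xvar K * zvar K ^+ q.-1 + yvar K ^+ q.-1 * zvar K - zvar K ^+ q.

Definition T2_curve (K : fieldType) (n : nat) (a b c : K) : {mpoly K[3]} :=
  a *: xvar K ^+ n + b *: yvar K ^+ n - c *: zvar K ^+ n.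

Lemma map_T3_curve (F K : fieldType) (iota : {rmorphism F -> K}) q :
  map_mpoly iota (T3_curve F q) = T3_curve K q.
Proof.
rewrite !(rmorphB, rmorphD, rmorphM, rmorphXn) /=.
by rewrite map_xvar map_yvar map_zvar.
Qed.

Lemma map_T3_twist (F K : fieldType) (iota : {rmorphism F -> K}) q :
  map_mpoly iota (T3_twist F q) = T3_twist K q.
Proof.
rewrite !(rmorphB, rmorphD, rmorphM, rmorphXn) /=.
by rewrite map_xvar map_yvar map_zvar.
Qed.

Lemma map_T2_curve (F K : fieldType) (iota : {rmorphism F -> K}) n a b c :
  map_mpoly iota (T2_curve n a b c) = T2_curve n (iota a) (iota b) (iota c).
Proof.
rewrite rmorphB rmorphD /= !map_mpolyZ !rmorphXn /=.
by rewrite map_xvar map_yvar map_zvar.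
Qed.

Lemma msize_T3_curve (K : fieldType) (q : nat) :
  (1 < q)%N -> msize (T3_curve K q) = q.+1.
Proof.
move=> q_gt1; have q_gt0 := ltnW q_gt1.
have [n q_eq] : exists n, q = n.+2 by case: q q_gt1 {q_gt0} => [|[|n]]//; exists n.
apply: dhomog_msizeS.
  apply: (nonzero_of_eval (v := fun i => (i == o30)%:R)).
  rewrite mevalB mevalD mevalB 2!mevalM 4!rmorphXn /= 3!mevalXU /= q_eq.
  by rewrite expr1n !expr0n mul1r mul0r subr0 addr0 subr0 oner_eq0.
rewrite !(rpredB, rpredD, rpredN) ?homogX //.
- exact: (homogXMX K o30 o32 q_gt0).
- exact: (homogXMX K o31 o30 q_gt0).
Qed.

Lemma msize_T3_twist (K : fieldType) (q : nat) :
  (1 < q)%N -> msize (T3_twist K q) = q.+1.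
Proof.
move=> q_gt1; have q_gt0 := ltnW q_gt1.
have [n q_eq] : exists n, q = n.+2 by case: q q_gt1 {q_gt0} => [|[|n]]//; exists n.
apply: dhomog_msizeS.
  rewrite /T3_twist; apply: (nonzero_of_eval (v := fun i => (i == o30)%:R)).
  rewrite mevalB mevalD mevalB 2!mevalM !rmorphXn /= 3!mevalXU /= q_eq.
  by rewrite expr1n !expr0n mul1r mul0r subr0 addr0 subr0 oner_eq0.
rewrite !(rpredB, rpredD, rpredN) ?homogX //.
- exact: (homogXMX K o30 o32 q_gt0).
- by rewrite mulrC; exact: (homogXMX K o32 o31 q_gt0).
Qed.

Lemma msize_T2_curve (K : fieldType) (n : nat) (a b c : K) :
  (0 < n)%N -> c != 0 -> msize (T2_curve n a b c) = n.+1.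
Proof.
move=> n_gt0 nz_c; apply: dhomog_msizeS.
  apply: (nonzero_of_eval (v := fun i => (i == o32)%:R)).
  rewrite mevalB mevalD 3!mevalZ 3!rmorphXn /= 3!mevalXU /=.
  by rewrite expr1n expr0n (gtn_eqF n_gt0) !mulr0 mulr1 !add0r oppr_eq0.
by rewrite rpredB ?rpredD ?rpredZ ?homogX.
Qed.

(** The equation is monic in y up to sign; its other coefficients vanish at
    x = 0, and the constant one has the nonzero derivative - z^(q-1) there. *)
Lemma T3_curve_irreducible (K : fieldType) (q : nat) :
  (1 < q)%N -> mirreducible (T3_curve K q).
Proof.
move=> q_gt1; have [n q_eq] : exists n, q = n.+2.
  by case: q q_gt1 => [|[|n]]//; exists n.
have [|S [kappa [t [phi [nz_t phiC [phi_y phi_x phi_z] unit_phi]]]]] :=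
  @tower_exists K o31 o30 o32; first by [].
apply: (mirreducible_trinomial (phi := phi) (n := q) (s := 0) (u := -1)
  (A := 'X^(q.-1)) (B := 'X^q - t ^+ q.-1 *: 'X)) => //.
- rewrite /T3_curve rmorphB rmorphD rmorphB !rmorphM !rmorphXn phi_x phi_y phi_z.
  rewrite -!mul_polyC !(rmorphB, rmorphN, rmorph1, rmorphXn, rmorphM) /=.
  by ring.
- by rewrite unitrN1.
- by rewrite q_eq hornerXn expr0n.
- by rewrite q_eq hornerD hornerN hornerZ hornerXn hornerX expr0n mulr0 subr0.
- rewrite derivB derivXn derivZ derivX hornerD hornerN hornerZ hornerMn hornerXn.
  rewrite hornerC mulr1 q_eq expr0n mul0rn sub0r oppr_eq0 expf_eq0 /=.
  exact: nz_t.
- by rewrite msize_T3_curve // q_eq.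
Qed.

(** The equation is monic in x; its other coefficients vanish at z = 0, and the
    constant one has the nonzero derivative y^(q-1) there. *)
Lemma T3_twist_irreducible (K : fieldType) (q : nat) :
  (1 < q)%N -> mirreducible (T3_twist K q).
Proof.
move=> q_gt1; have [n q_eq] : exists n, q = n.+2.
  by case: q q_gt1 => [|[|n]]//; exists n.
have [|S [kappa [t [phi [nz_t phiC [phi_x phi_z phi_y] unit_phi]]]]] :=
  @tower_exists K o30 o32 o31; first by [].
apply: (mirreducible_trinomial (phi := phi) (n := q) (s := 0) (u := 1)
  (A := - 'X^(q.-1)) (B := t ^+ q.-1 *: 'X - 'X^q)) => //.
- rewrite /T3_twist rmorphB rmorphD rmorphB !rmorphM !rmorphXn phi_x phi_y phi_z.
  rewrite -!mul_polyC !(rmorphB, rmorphN, rmorph1, rmorphXn, rmorphM) /=.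
  by ring.
- by rewrite unitr1.
- by rewrite q_eq hornerN hornerXn expr0n oppr0.
- by rewrite q_eq hornerD hornerN hornerZ hornerXn hornerX expr0n mulr0 subr0.
- rewrite derivB derivXn derivZ derivX hornerD hornerN hornerZ hornerMn hornerXn.
  rewrite hornerC mulr1 q_eq expr0n mul0rn subr0 expf_eq0 /=.
  exact: nz_t.
- by rewrite msize_T3_twist // q_eq.
Qed.

(** The constant coefficient in z is a x^n + b y^n, which has simple linear
    factors because n is invertible. *)
Lemma T2_curve_irreducible (K : closedFieldType) (n : nat) (a b c : K) :
  (1 < n)%N -> n%:R != 0 :> K -> a != 0 -> b != 0 -> c != 0 ->
  mirreducible (T2_curve n a b c).
Proof.
move=> n_gt1 nz_n nz_a nz_b nz_c.
have [m n_eq] : exists m, n = m.+2 by case: n n_gt1 {nz_n} => [|[|m]]//; exists m.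
(* The prime of the Eisenstein argument is y - rho x, a factor of a x^n + b y^n. *)
have [rho rho_eq] : exists rho, a + b * rho ^+ n = 0.
  have [r] :=
    @solve_monicpoly K n (fun i => if i == 0%N then - a / b else 0) (ltnW n_gt1).
  rewrite (bigD1 (Ordinal (ltnW n_gt1))) //= big1 => [r_eq|i]; last first.
    by rewrite -val_eqE /= => /negPf->; rewrite mul0r.
  by exists r; rewrite r_eq expr0 mulr1 addr0 mulrC divfK // subrr.
have nz_rho : rho != 0.
  by apply: contra_eq_neq rho_eq => ->; rewrite n_eq expr0n mulr0 addr0.
have [|S [kappa [t [phi [nz_t phiC [phi_z phi_y phi_x] unit_phi]]]]] :=
  @tower_exists K o32 o31 o30; first by [].
have nz_kappa d : d != 0 -> kappa d != 0 by rewrite fmorph_eq0.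
apply: (mirreducible_trinomial (phi := phi) (n := n) (s := kappa rho * t)
  (u := - kappa c) (A := 0) (B := (kappa a * t ^+ n)%:P + kappa b *: 'X^n)) => //.
- rewrite /T2_curve rmorphB rmorphD -!mul_mpolyC !rmorphM !rmorphXn /= !phiC.
  rewrite phi_x phi_y phi_z.
  rewrite -!mul_polyC !(rmorphD, rmorphN, rmorph0, rmorphXn, rmorphM) /=.
  by ring.
- by rewrite rpredN rmorph_unit // unitfE.
- by rewrite horner0.
- rewrite hornerD hornerC hornerZ hornerXn exprMn mulrA -mulrDl -rmorphXn.
  by rewrite -rmorphM -rmorphD rho_eq rmorph0 mul0r.
- rewrite derivD derivC add0r derivZ derivXn hornerZ hornerMn hornerXn.
  rewrite -mulr_natr -(rmorph_nat kappa) !mulf_neq0 ?expf_neq0 ?mulf_neq0 //;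
  by apply: nz_kappa.
- by rewrite msize_T2_curve // ltnW.
Qed.

Lemma proj_equiv_refl (F : fieldType) (f : {mpoly F[3]}) : proj_equiv f f.
Proof.
exists 1%:M; first exact: unitmx1.
by rewrite /maps_onto lin_subst1; exact: same_curve_refl.
Qed.

Lemma T3_curve_type_T3 (F : finFieldType) : type_T3 (T3_curve F #|F|).
Proof.
rewrite /type_T3 /T3_curve [yvar F * _]mulrC; exact: proj_equiv_refl.
Qed.

(** The signs match because (-1)^q = -1 in F, whatever the characteristic. *)
Lemma T3_twist_type_T3 (F : finFieldType) : type_T3 (T3_twist F #|F|).
Proof.
(* The substitution x := -z, y := -x, z := y. *)
pose s := [:: [:: 0; 0; -1]; [:: -1; 0; 0]; [:: 0; 1; 0 : F]].
pose A : 'M[F]_3 := \matrix_(i, j) (nth [::] s i)`_j.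
exists A.
  apply: (proj1 (@mulmx1_unit _ _ A A^T _)).
  apply/matrixP; elim/ord3P; elim/ord3P; rewrite !mxE sum3E !mxE /=;
  by rewrite ?(mulr0, mul0r, mulr1, mulrN1, opprK, addr0, add0r).
rewrite /maps_onto; set q := #|F|; pose x := xvar F; pose y := yvar F; pose z := zvar F.
have AX i : lin_subst A 'X_i = A i o30 *: x + A i o31 *: y + A i o32 *: z.
  exact: etrans (lin_substXE _ _) (sum3E _).
have Ax : lin_subst A x = - z by rewrite AX !mxE /= !scale0r !add0r scaleN1r.
have Ay : lin_subst A y = - x by rewrite AX !mxE /= !scale0r !addr0 scaleN1r.
have Az : lin_subst A z = y by rewrite AX !mxE /= !scale0r addr0 add0r scale1r.
have N1q : (-1) ^+ q = -1 :> {mpoly F[3]}.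
  have := mpolyZ_card (-1) (1 : {mpoly F[3]}).
  by rewrite expr1n !scaleN1r.
have N1q1 : (-1) ^+ q.-1 = 1 :> {mpoly F[3]}.
  apply: (mulfI (x := -1)); first by rewrite oppr_eq0 oner_eq0.
  by rewrite -exprS prednK_card N1q mulr1.
suff -> : lin_subst A (x ^+ q - x * z ^+ q.-1 + x ^+ q.-1 * y - y ^+ q) = T3_twist F q.
  exact: same_curve_refl.
rewrite /lin_subst in Ax Ay Az *.
rewrite rmorphB rmorphD rmorphB !rmorphM !rmorphXn /= Ax Ay Az.
rewrite (exprNn z) (exprNn z) (exprNn x) N1q N1q1 /T3_twist -/x -/y -/z.
by ring.
Qed.

Lemma T2_curve_type_T2 (F : finFieldType) (a b : F) :
  a * b * (a + b) != 0 -> type_T2 (T2_curve #|F|.-1 a b (a + b)).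
Proof.
move=> nz; exists a, b, (- (a + b)); split; rewrite ?mulrN ?oppr_eq0 ?subrr //.
by rewrite scaleNr; exact: proj_equiv_refl.
Qed.

(** Over F_2 nonzero a and b are both 1 and have sum 0: the case of a nonlinear
    component that would be a line does not occur. *)
Lemma card_gt2_of_sum_neq0 (F : finFieldType) (a b : F) :
  a * b * (a + b) != 0 -> (2 < #|F|)%N.
Proof.
rewrite !mulf_eq0 !negb_or -andbA => /and3P[nz_a nz_b nz_ab].
have := finNzRing_gt1 F; rewrite leq_eqVlt => /predU1P[q2|//].
have unit1 (c : F) : c != 0 -> c = 1.
  by move=> nz_c; apply: (mulfI nz_c); rewrite mulr1 -expr2 q2 expf_card.
case/eqP: nz_ab; rewrite (unit1 a) // (unit1 b) //.
by have := card_finField_eq0 F; rewrite -q2 mulr2n.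
Qed.

Lemma T2_component (F : finFieldType) (a b : F) :
  a * b * (a + b) != 0 ->
  the_nonlinear_component (xvar F * yvar F * T2_curve #|F|.-1 a b (a + b))
    (T2_curve #|F|.-1 a b (a + b)).
Proof.
move=> nz; have q_gt2 := card_gt2_of_sum_neq0 nz.
have q1_gt1 : (1 < #|F|.-1)%N by rewrite -subn1 ltn_subRL.
move: nz; rewrite !mulf_eq0 !negb_or -andbA => /and3P[nz_a nz_b nz_ab].
have -> : xvar F * yvar F = \prod_(i <- [:: o30; o31]) 'X_i.
  by rewrite !big_cons big_nil mulr1.
apply: the_nonlinear_component_mulX; last by rewrite msize_T2_curve // ltnW.
move=> K iota; rewrite map_T2_curve.
apply: T2_curve_irreducible; rewrite ?fmorph_eq0 //.
(* q - 1 is invertible in K because q vanishes there. *)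
have : (#|F|.-1)%:R + 1 = 0 :> K.
  by rewrite -mulrSr prednK_card -(rmorph_nat iota) card_finField_eq0 rmorph0.
by apply: contra_eq_neq => ->; rewrite add0r oner_neq0.
Qed.

Lemma T3_component (F : finFieldType) :
  the_nonlinear_component (xvar F * T3_curve F #|F|) (T3_curve F #|F|).
Proof.
have q_gt1 := finNzRing_gt1 F.
have -> : xvar F = \prod_(i <- [:: o30]) 'X_i by rewrite big_cons big_nil mulr1.
apply: the_nonlinear_component_mulX; last by rewrite msize_T3_curve.
by move=> K iota; rewrite map_T3_curve; apply: T3_curve_irreducible.
Qed.

Lemma T3_twist_component (F : finFieldType) :
  the_nonlinear_component (yvar F * T3_twist F #|F|) (T3_twist F #|F|).
Proof.
have q_gt1 := finNzRing_gt1 F.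
have -> : yvar F = \prod_(i <- [:: o31]) 'X_i by rewrite big_cons big_nil mulr1.
apply: the_nonlinear_component_mulX; last by rewrite msize_T3_twist.
by move=> K iota; rewrite map_T3_twist; apply: T3_twist_irreducible.
Qed.

(** * The nonsingular curve *)

Lemma mderivXn (K : fieldType) (n : nat) (i : 'I_n) (p : {mpoly K[n]}) (k : nat) :
  mderiv i (p ^+ k) = (p ^+ k.-1 * mderiv i p) *+ k.
Proof.
elim: k => [|[|k] IHk]; first by rewrite expr0 mulr0n -mpolyC1 mderivC.
  by rewrite expr1 expr0 mul1r.
rewrite exprS mderivM IHk [in RHS]mulrS; congr (_ + _); first by rewrite mulrC.
by rewrite -mulrnAr mulrA -exprS mulrnAr.
Qed.

Lemma mderivXU (K : fieldType) (n : nat) (i j : 'I_n) :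
  mderiv i ('X_j : {mpoly K[n]}) = (j == i)%:R.
Proof.
rewrite mderivX mnm1E; case: eqP => [->|_]; last by rewrite scale0r.
rewrite scale1r -[RHS]mpolyX0; congr mpolyX; apply/mnmP => k.
by rewrite mnmBE subnn mnm0E.
Qed.

Definition smooth_curve (K : fieldType) (q : nat) : {mpoly K[3]} :=
  xvar K ^+ q.+1 - xvar K ^+ 2 * zvar K ^+ q.-1 + yvar K ^+ q * zvar K
  - yvar K * zvar K ^+ q.

(** The derivative in y is - z^q, so z = 0 at a singular point; there the equation
    becomes x^(q+1) = 0 and the derivative in z becomes y^q. *)
Lemma smooth_curve_nonsingular (F : finFieldType) : nonsingular (smooth_curve F #|F|).
Proof.
move=> K iota v nz_v; set q := #|F|; set f := map_mpoly _ _.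
have q0 : q%:R = 0 :> K by rewrite -(rmorph_nat iota) card_finField_eq0 rmorph0.
have q_gt0 : (0 < q)%N by rewrite ltnW // finNzRing_gt1.
have f_eq : f = smooth_curve K q.
  rewrite /f /smooth_curve rmorphB rmorphD rmorphB !rmorphM !rmorphXn /=.
  by rewrite map_xvar map_yvar map_zvar.
have mulq (p : {mpoly K[3]}) : p *+ q = 0.
  by rewrite -scaler_nat q0 scale0r.
set a := v 0 o30; set b := v 0 o31; set c := v 0 o32.
have evx : (xvar K).@[v 0] = a by exact: mevalXU.
have evy : (yvar K).@[v 0] = b by exact: mevalXU.
have evz : (zvar K).@[v 0] = c by exact: mevalXU.
have dxy : mderiv o31 (xvar K) = 0 by rewrite mderivXU.
have dyy : mderiv o31 (yvar K) = 1 by rewrite mderivXU.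
have dzy : mderiv o31 (zvar K) = 0 by rewrite mderivXU.
have dxz : mderiv o32 (xvar K) = 0 by rewrite mderivXU.
have dyz : mderiv o32 (yvar K) = 0 by rewrite mderivXU.
have dzz : mderiv o32 (zvar K) = 1 by rewrite mderivXU.
have fy : (mderiv o31 f).@[v 0] = - c ^+ q.
  rewrite f_eq /smooth_curve mderivB mderivD mderivB !mderivM !mderivXn.
  rewrite dxy dyy dzy !(mulr0, mul0r, mul0rn, addr0, add0r, subr0, mul1r) mulq.
  rewrite !(mul0r, addr0, oppr0, sub0r).
  by rewrite mevalN rmorphXn /= evz.
have fz : (mderiv o32 f).@[v 0] = - (a ^+ 2 * c ^+ q.-2 *+ q.-1) + b ^+ q.
  rewrite f_eq /smooth_curve mderivB mderivD mderivB !mderivM !mderivXn.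
  rewrite dxz dyz dzz !(mulr0, mul0r, mul0rn, addr0, add0r, subr0, mulr1) mulq.
  rewrite !(mulr0, subr0, oppr0, sub0r).
  by rewrite mevalD mevalN mevalM mevalMn 3!rmorphXn /= evx evy evz mulrnAr.
have fE : f.@[v 0] = a ^+ q.+1 - a ^+ 2 * c ^+ q.-1 + b ^+ q * c - b * c ^+ q.
  rewrite f_eq /smooth_curve mevalB mevalD mevalB.
  rewrite (mevalM _ (_ ^+ 2)) (mevalM _ (yvar K ^+ q)) (mevalM _ (yvar K)).
  by rewrite !rmorphXn /= evx evy evz.
rewrite fE => f0.
have [c0|nz_c] := eqVneq c 0; last by exists o31; rewrite fy oppr_eq0 expf_neq0.
have q_gt1 : (0 < q.-1)%N by rewrite -subn1 subn_gt0 finNzRing_gt1.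
have a0 : a = 0.
  apply/eqP; move/eqP: f0; rewrite c0 !expr0n (gtn_eqF q_gt0) (gtn_eqF q_gt1).
  by rewrite !mulr0 subr0 addr0 subr0 expf_eq0.
exists o32; rewrite fz a0 expr0n mul0r mul0rn oppr0 add0r expf_eq0 q_gt0 /=.
apply: contraNneq nz_v => b0; apply/eqP/rowP; elim/ord3P; rewrite mxE //.
Qed.

(** * Pencils of lines *)

(** As polynomials in f, both sides are monic of degree q = #|F|, and they agree
    at the q distinct values phi c * g. *)
Lemma prod_card_sub (F : finFieldType) (R : idomainType)
    (phi : {rmorphism F -> R}) (f g : R) :
  g != 0 -> f ^+ #|F| - f * g ^+ #|F|.-1 = \prod_(c : F) (f - phi c * g).
Proof.
move=> nz_g; set q := #|F|; have q_gt1 : (1 < q)%N := finNzRing_gt1 F.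
pose p1 : {poly R} := 'X^q - g ^+ q.-1 *: 'X.
pose p2 : {poly R} := \prod_(c : F) ('X - (phi c * g)%:P).
have sz_p2 : size p2 = q.+1 by rewrite size_prod_XsubC /index_enum -enumT -cardE.
have p12 : p1 - p2 = 0.
  apply: (roots_geq_poly_eq0 (rs := [seq phi c * g | c <- enum F])).
  - apply/allP => _ /mapP[c _ ->]; rewrite rootE hornerD hornerN horner_prod.
    rewrite (bigD1 c) //= hornerXsubC subrr mul0r subr0 hornerD hornerN hornerZ.
    rewrite hornerXn hornerX exprMn -rmorphXn expf_card mulrCA -exprSr.
    by rewrite prednK_card subrr.
  - rewrite map_inj_uniq ?enum_uniq // => c d /(mulIf nz_g); exact: fmorph_inj.
  - rewrite size_map -cardE; apply/leq_sizeP => i.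
    rewrite leq_eqVlt => /predU1P[<-|lt_qi].
    + have /eqP := monic_prod_XsubC (index_enum F) xpredT (fun c : F => phi c * g).
      rewrite !coefB coefXn coefZ coefX eqxx gtn_eqF // mulr0 subr0 -/p2.
      by rewrite lead_coefE sz_p2 => ->; rewrite subrr.
    + rewrite !coefB coefXn coefZ coefX !gtn_eqF ?(ltn_trans q_gt1) // mulr0 !sub0r.
      by rewrite nth_default ?oppr0 ?subr0 ?addr0 // sz_p2.
have := congr1 (horner^~ f) (subr0_eq p12).
rewrite horner_prod hornerD hornerN hornerZ hornerXn hornerX mulrC => ->.
by apply: eq_bigr => c _; rewrite hornerXsubC.
Qed.

Lemma prod_card_subZ (F : finFieldType) (n : nat) (f g : {mpoly F[n]}) :
  g != 0 -> f ^+ #|F| - f * g ^+ #|F|.-1 = \prod_(c : F) (f - c *: g).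
Proof.
move=> nz_g; rewrite (prod_card_sub (@mpolyC n F) f nz_g).
by apply: eq_bigr => c _; rewrite mul_mpolyC.
Qed.

Lemma line_form_delta (F : fieldType) (i : 'I_3) :
  line_form (delta_mx 0 i : 'rV[F]_3) = 'X_i.
Proof.
rewrite /line_form (bigD1 i) //= mxE !eqxx scale1r big1 ?addr0 // => j ne_ji.
by rewrite mxE eqxx (negPf ne_ji) scale0r.
Qed.

(** The lines x_i = c x_j; together with x_j = 0 they are the lines through the
    third vertex of the coordinate triangle. *)
Definition pencil_line (F : fieldType) (i j : 'I_3) (c : F) : 'rV[F]_3 :=
  delta_mx 0 i - c *: delta_mx 0 j.

Lemma line_form_pencil (F : fieldType) (i j : 'I_3) (c : F) :
  line_form (pencil_line i j c) = 'X_i - c *: 'X_j.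
Proof.
rewrite -(line_form_delta F i) -(line_form_delta F j) /line_form scaler_sumr -sumrB.
by apply: eq_bigr => k _; rewrite scalerA -scalerBl !mxE.
Qed.

Lemma pencil_line0 (F : fieldType) (i j : 'I_3) :
  pencil_line i j (0 : F) = delta_mx 0 i.
Proof. by rewrite /pencil_line scale0r subr0. Qed.

Lemma pencil_line_i (F : fieldType) (i j : 'I_3) (c : F) :
  i != j -> pencil_line i j c 0 i = 1.
Proof. by move=> /negPf ne_ij; rewrite !mxE !eqxx ne_ij mulr0 subr0. Qed.

Lemma pencil_line_j (F : fieldType) (i j : 'I_3) (c : F) :
  i != j -> pencil_line i j c 0 j = - c.
Proof. by rewrite eq_sym => /negPf ne_ij; rewrite !mxE !eqxx ne_ij mulr1 add0r. Qed.

Lemma pencil_line_neq0 (F : fieldType) (i j : 'I_3) (c : F) :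
  i != j -> pencil_line i j c != 0.
Proof.
by move=> ne_ij; apply/eqP => /rowP/(_ i)/eqP; rewrite pencil_line_i // mxE oner_eq0.
Qed.

Lemma ppoint_pencil_inj (F : finFieldType) (i j : 'I_3) :
  i != j -> injective (fun c : F => ppoint (pencil_line i j c)).
Proof.
move=> ne_ij c d /ppoint_eq[e _ /rowP cd].
have := cd i; rewrite [RHS]mxE !pencil_line_i // mulr1 => e1.
by have := cd j; rewrite [RHS]mxE !pencil_line_j // -e1 mul1r => /oppr_inj.
Qed.

Lemma delta_neq0 (F : fieldType) (i : 'I_3) : (delta_mx 0 i : 'rV[F]_3) != 0.
Proof. by apply/eqP => /rowP/(_ i)/eqP; rewrite !mxE !eqxx oner_eq0. Qed.

Lemma passes_through_delta (F : fieldType) (k : 'I_3) (l : 'rV[F]_3) :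
  passes_through (delta_mx 0 k) l = (l 0 k == 0).
Proof.
rewrite /passes_through /line_form raddf_sum (bigD1 k) //= big1 => [|j ne_jk].
  by rewrite mevalZ mevalXU mxE !eqxx mulr1 addr0.
by rewrite mevalZ mevalXU mxE eqxx (negPf ne_jk) mulr0.
Qed.

Lemma prod_pencil (F : finFieldType) (i j : 'I_3) :
  \prod_(l <- [seq pencil_line i j c | c <- enum F]) line_form l
  = ('X_i ^+ #|F| - 'X_i * 'X_j ^+ #|F|.-1 : {mpoly F[3]}).
Proof.
rewrite prod_card_subZ; last by rewrite -msize_poly_eq0 msizeX.
by rewrite big_map big_enum; apply: eq_bigr => c _; exact: line_form_pencil.
Qed.

(** The equation is x_j times the product of the x_i - c x_j. *)
Lemma union_of_pencil (F : finFieldType) (i j k : 'I_3) :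
  uniq [:: i; j; k] ->
  union_of_all_lines_through (delta_mx 0 k)
    ('X_i ^+ #|F| * 'X_j - 'X_i * 'X_j ^+ #|F| : {mpoly F[3]}).
Proof.
move=> uijk; have := uijk.
rewrite /= !inE negb_or andbT => /andP[/andP[ne_ij ne_ik] ne_jk].
have nE := (negPf ne_ij, negPf ne_ik, negPf ne_jk).
have nE' : ((j == i) = false) * ((k == i) = false) * ((k == j) = false).
  by rewrite !(eq_sym _ i) (eq_sym k) !nE.
set ls := delta_mx 0 j :: [seq pencil_line i j c | c <- enum F].
have uniq_ls : distinct_lines ls.
  rewrite /distinct_lines /= -map_comp map_inj_uniq ?enum_uniq ?andbT; last first.
    exact: ppoint_pencil_inj.
  apply/mapP => -[c _ /ppoint_eq[e nz_e /rowP/(_ i)]].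
  rewrite mxE [RHS]mxE pencil_line_i // eqxx !nE mulr1 => /eqP.
  by rewrite eq_sym (negPf nz_e).
have mem_ls : [seq ppoint l | l <- ls] =i lines_through (delta_mx 0 k : 'rV[F]_3).
  move=> L; apply/mapP/imsetP => -[l].
    rewrite inE => l_ls ->; exists l; rewrite // inE passes_through_delta.
    case/predU1P: l_ls => [->|/mapP[c _ ->]].
      by rewrite delta_neq0 mxE !nE' andbF eqxx.
    by rewrite pencil_line_neq0 // !mxE !nE' !andbF mulr0 subrr eqxx.
  rewrite inE passes_through_delta => /andP[nz_l /eqP lk0] ->.
  have cover m : [|| m == i, m == j | m == k].
    have [_ cov] := uniq_min_size uijk (fun n _ => mem_enum 'I_3 n)
                                  (eq_leq (size_enum_ord 3)).
    by have := mem_enum 'I_3 m; rewrite -cov !inE.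
  (* A line through the point is X_j = 0, or X_i = c X_j with c = - l_j / l_i. *)
  have [li0|nz_li] := eqVneq (l 0 i) 0.
    have l_eq : l = l 0 j *: delta_mx 0 j.
      apply/rowP => m; rewrite !mxE eqxx.
      case/or3P: (cover m) => /eqP->; rewrite ?li0 ?lk0 ?nE ?nE' ?eqxx ?mulr1 ?mulr0 //.
    have nz_lj : l 0 j != 0 by apply: contraNneq nz_l => lj0; rewrite l_eq lj0 scale0r.
    by exists (delta_mx 0 j); rewrite ?inE ?eqxx // l_eq ppointZ.
  exists (pencil_line i j (- (l 0 j / l 0 i))).
    by rewrite inE map_f ?orbT // mem_enum.
  rewrite -[RHS](ppointZ _ nz_li); congr ppoint; apply/rowP => m; rewrite mxE.
  case/or3P: (cover m) => /eqP->.
  - by rewrite pencil_line_i // mulr1.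
  - by rewrite pencil_line_j // opprK mulrC divfK.
  - by rewrite lk0 !mxE !nE' !andbF mulr0 subrr mulr0.
split.
  rewrite -(eq_card mem_ls) (card_uniqP uniq_ls) size_map /= size_map.
  by rewrite -cardE.
exists ls; split=> //; split.
  rewrite /= delta_neq0; apply/allP => _ /mapP[c _ ->]; exact: pencil_line_neq0.
rewrite /ls big_cons prod_pencil line_form_delta -[X in 'X_i * _ ^+ X]prednK_card.
suff -> : ('X_i ^+ #|F| * 'X_j - 'X_i * 'X_j ^+ #|F|.-1.+1 : {mpoly F[3]}) =
  'X_j * ('X_i ^+ #|F| - 'X_i * 'X_j ^+ #|F|.-1) by exact: same_curve_refl.
by rewrite exprS; ring.
Qed.

Lemma pencil_and_line (F : finFieldType)
    (C := yvar F * (xvar F ^+ #|F| - xvar F * zvar F ^+ #|F|.-1))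
    (P := vec3 0 1 0) :
  exists (l0 : 'rV[F]_3) (ls : seq 'rV[F]_3),
    [/\ consists_of_lines C (l0 :: ls), size ls = #|F|, distinct_lines ls,
        all (passes_through P) ls & ~~ passes_through P l0].
Proof.
exists (delta_mx 0 o31), [seq pencil_line o30 o32 c | c <- enum F].
rewrite /P vec3_010; split.
- split.
    rewrite /= delta_neq0; apply/allP => _ /mapP[c _ ->].
    exact: pencil_line_neq0.
  by rewrite big_cons prod_pencil line_form_delta; exact: same_curve_refl.
- by rewrite size_map -cardE.
- rewrite /distinct_lines -map_comp map_inj_uniq ?enum_uniq //.
  exact: ppoint_pencil_inj.
- apply/allP => _ /mapP[c _ ->]; rewrite passes_through_delta !mxE /=.
  by rewrite mulr0 subrr.
- by rewrite passes_through_delta mxE oner_eq0.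
Qed.

Lemma pencil_with_double_line (F : finFieldType)
    (C := xvar F ^+ 2 * (xvar F ^+ #|F|.-1 - zvar F ^+ #|F|.-1)) :
  exists (l0 : 'rV[F]_3) (ls : seq 'rV[F]_3) (P : 'rV[F]_3),
    [/\ consists_of_lines C [:: l0, l0 & ls], size ls = #|F|.-1,
        distinct_lines (l0 :: ls), P != 0
      & all (passes_through P) (l0 :: ls)].
Proof.
(* The double line x = 0 is the member c = 0 of the pencil x = c z. *)
pose cs := rem 0 (enum F); pose line (c : F) := pencil_line o30 o32 c.
have cs_enum : perm_eq (0 :: cs) (enum F) by rewrite perm_sym perm_to_rem ?mem_enum.
exists (line 0), [seq line c | c <- cs], (delta_mx 0 o31).
have nz_lines : all (fun l => l != 0) [seq line c | c <- 0 :: cs].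
  by apply/allP => _ /mapP[c _ ->]; exact: pencil_line_neq0.
split.
- split; first by move: nz_lines => /= /andP[->].
  have := prod_pencil F o30 o32; rewrite -(perm_big _ (perm_map line cs_enum)) big_cons.
  rewrite !big_cons => ->; rewrite /line pencil_line0 line_form_delta.
  by rewrite /C expr2 exprS_card -mulrA -mulrBr; exact: same_curve_refl.
- by rewrite size_map size_rem ?mem_enum // -cardE.
- rewrite /distinct_lines -map_cons -map_comp map_inj_uniq; last first.
    exact: ppoint_pencil_inj.
  by rewrite (perm_uniq cs_enum) enum_uniq.
- exact: delta_neq0.
- rewrite -map_cons; apply/allP => _ /mapP[c _ ->].
  by rewrite passes_through_delta !mxE /= mulr0 subrr.
Qed.

(** * The equations of the normal forms *)

Lemma Gpoly_antidiag (F : finFieldType) (a b : F) :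
  Gpoly (mx23 0 a 0 b 0 0) = xvar F * yvar F * T2_curve #|F|.-1 a b (a + b).
Proof.
rewrite Gpoly_mx23 /T2_curve !exprS_card -!mul_mpolyC mpolyCD mpolyC0; ring.
Qed.

Lemma Gpoly_nilpotent_rank2 (F : finFieldType) :
  Gpoly (mx23 (0 : F) 1 0 0 0 1) = yvar F * T3_twist F #|F|.
Proof.
rewrite Gpoly_mx23 /T3_twist !exprS_card mpolyC0 mpolyC1; ring.
Qed.

Lemma Gpoly_nilpotent_rank1 (F : finFieldType) :
  Gpoly (mx23 (0 : F) 1 0 0 0 0) =
  yvar F * (xvar F ^+ #|F| - xvar F * zvar F ^+ #|F|.-1).
Proof. rewrite Gpoly_mx23 mpolyC0 mpolyC1; ring. Qed.

Lemma Gpoly_invertible_double (F : finFieldType) :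
  Gpoly (mx23 (1 : F) 1 0 (-1) 0 0) = xvar F * T3_curve F #|F|.
Proof.
rewrite Gpoly_mx23 /T3_curve !exprS_card mpolyCN mpolyC0 mpolyC1; ring.
Qed.

Lemma Gpoly_square_rank2 (F : finFieldType) :
  Gpoly (mx23 (1 : F) 0 0 0 0 1) = smooth_curve F #|F|.
Proof.
rewrite Gpoly_mx23 /smooth_curve (exprS _ #|F|) !exprS_card mpolyC0 mpolyC1; ring.
Qed.

Lemma Gpoly_square_rank1 (F : finFieldType) :
  Gpoly (mx23 (1 : F) 0 0 0 0 0) =
  xvar F ^+ 2 * (xvar F ^+ #|F|.-1 - zvar F ^+ #|F|.-1).
Proof. rewrite Gpoly_mx23 !exprS_card mpolyC0 mpolyC1; ring. Qed.

Lemma Gpoly_alternating (F : finFieldType) :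
  Gpoly (mx23 (0 : F) 1 0 (-1) 0 0) = xvar F ^+ #|F| * yvar F - xvar F * yvar F ^+ #|F|.
Proof. rewrite Gpoly_mx23 mpolyCN mpolyC0 mpolyC1; ring. Qed.

Lemma Gpoly_last_column (F : finFieldType) :
  Gpoly (mx23 (0 : F) 0 1 0 0 0) = xvar F ^+ #|F| * zvar F - xvar F * zvar F ^+ #|F|.
Proof. rewrite Gpoly_mx23 !exprS_card mpolyC0 mpolyC1; ring. Qed.

(** * The classification *)

Unset Implicit Arguments.

Theorem theorem6p10 (F : finFieldType) (M : 'M[F]_(2, 3)) :
  let q := #|F| in
  let x := xvar F in let y := yvar F in let z := zvar F in
  let M' := lpart M in
  let g := gpoly M' in
  let G := Gpoly M in
  mreducible g \/ g = 0 ->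
  (* (I) *)
  (has_two_distinct_roots g ->
    [/\ nb_points_at_infinity G = 2%N,
        (* (I-1) *)
        \det M' != 0 ->
          exists a1 b0 : F,
            let h := a1 *: x ^+ q.-1 + b0 *: y ^+ q.-1
                     - (a1 + b0) *: z ^+ q.-1 in
            [/\ a1 * b0 * (a1 + b0) != 0,
                B_equiv G (x * y * h),
                the_nonlinear_component (x * y * h) h
              & type_T2 h],
        (* (I-2) *)
        \det M' = 0 -> \rank M = 2%N ->
          let h := x ^+ q - x * z ^+ q.-1 + y ^+ q.-1 * z - z ^+ q in
          [/\ B_equiv G (y * h),
              the_nonlinear_component (y * h) h
            & type_T3 h]
      & (* (I-3) *)
        \det M' = 0 -> \rank M = 1%N ->
          let C := y * (x ^+ q - x * z ^+ q.-1) in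
          let P := vec3 0 1 0 in
          B_equiv G C /\
          exists (l0 : 'rV[F]_3) (ls : seq 'rV[F]_3),
            [/\ consists_of_lines C (l0 :: ls),
                size ls = q,
                distinct_lines ls,
                all (passes_through P) ls
              & ~~ passes_through P l0]]) /\
  (* (II) *)
  (has_double_root g ->
    [/\ nb_points_at_infinity G = 1%N,
        (* (II-1) *)
        \det M' != 0 ->
          let h := x ^+ q - x * z ^+ q.-1 + y * x ^+ q.-1 - y ^+ q in
          [/\ B_equiv G (x * h),
              the_nonlinear_component (x * h) h
            & type_T3 h],
        (* (II-2) *)
        \det M' = 0 -> \rank M = 2%N ->
          let C := x ^+ q.+1 - x ^+ 2 * z ^+ q.-1 + y ^+ q * z - y * z ^+ q in
          B_equiv G C /\ nonsingular C
      & (* (II-3) *)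
        \det M' = 0 -> \rank M = 1%N ->
          let C := x ^+ 2 * (x ^+ q.-1 - z ^+ q.-1) in
          B_equiv G C /\
          exists (l0 : 'rV[F]_3) (ls : seq 'rV[F]_3) (P : 'rV[F]_3),
            [/\ consists_of_lines C [:: l0, l0 & ls],
                size ls = q.-1,
                distinct_lines (l0 :: ls),
                P != 0
              & all (passes_through P) (l0 :: ls)]]) /\
  (* (III) *)
  (g = 0 ->
    [/\ G != 0 -> pzeros G = pspace F 3,
        (* (III-1) *)
        \det M' != 0 ->
          let C := x ^+ q * y - x * y ^+ q in
          B_equiv G C /\ union_of_all_lines_through (vec3 0 0 1) C,
        (* (III-2) *)
        ~ (exists N : 'M[F]_(2, 3),
             [/\ gpoly (lpart N) = 0, \det (lpart N) = 0 & \rank N = 2%N])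
      & (* (III-3) *)
        \det M' = 0 -> \rank M = 1%N ->
          let C := x ^+ q * z - x * z ^+ q in
          B_equiv G C /\ union_of_all_lines_through (vec3 0 1 0) C]).
Proof.
move=> q x y z M' g G _; split; last split.
- move=> g_roots; have [a [a2 [b [b2 [MN nz_ab]]]]] := two_roots_normal_form g_roots.
  split.
  + by rewrite infinity_pzeros; case: g_roots.
  + rewrite (congruent_det MN) lpart_mx23 det_mx22 mul0r sub0r oppr_eq0 => nz_det.
    move: (nz_det); rewrite mulf_eq0 negb_or => /andP[nz_a nz_b].
    have nz_h : a * b * (a + b) != 0 by rewrite mulf_neq0.
    exists a, b; split=> //.
    * rewrite -[X in B_equiv G X]Gpoly_antidiag; apply: congruent_B_equiv.
      exact: congruent_trans MN (congruent_antidiag _ _ nz_a nz_b).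
    * exact: T2_component nz_h.
    * exact: T2_curve_type_T2 nz_h.
  + move=> det0 rank2.
    have [c [c2 [d2 [MN1 nz_c]]]] := two_roots_one_entry MN nz_ab det0.
    have nz_d2 : d2 != 0.
      apply: contra_eq_neq rank2 => d20; rewrite (congruent_rank MN1) d20.
      by rewrite neq_ltn ltnS rank_row2_eq0.
    split; last exact: T3_twist_type_T3.
    * rewrite -[X in B_equiv G X]Gpoly_nilpotent_rank2; apply: congruent_B_equiv.
      exact: congruent_trans MN1 (congruent_nilpotent_rank2 _ nz_c nz_d2).
    * exact: T3_twist_component.
  + move=> det0 rank1.
    have [c [c2 [d2 [MN1 nz_c]]]] := two_roots_one_entry MN nz_ab det0.
    have d20 : d2 = 0.
      apply/eqP; apply: contra_eqT rank1 => nz_d2.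
      rewrite (congruent_rank MN1) (@rank_minor _ _ o31 o32) //.
      by rewrite !mxE /= mulr0 subr0 mulf_neq0.
    split; last exact: pencil_and_line.
    rewrite -[X in B_equiv G X]Gpoly_nilpotent_rank1; apply: congruent_B_equiv.
    rewrite d20 in MN1; exact: congruent_trans MN1 (congruent_nilpotent_rank1 _ nz_c).
- move=> g_roots; have [a [e [a2 [b2 [MN nz_a]]]]] := double_root_normal_form g_roots.
  have det_e : (\det M' == 0) = (e == 0).
    rewrite (congruent_det MN) lpart_mx23 det_mx22.
    by rewrite mulr0 sub0r mulrN opprK mulf_eq0 orbb.
  split.
  + by rewrite infinity_pzeros; exact: card_pzeros_double_root.
  + rewrite det_e => nz_e; split.
    * rewrite -[X in B_equiv G X]Gpoly_invertible_double; apply: congruent_B_equiv.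
      exact: congruent_trans MN (congruent_invertible_double _ _ nz_a nz_e).
    * exact: T3_component.
    * exact: T3_curve_type_T3.
  + move=> /eqP; rewrite det_e => /eqP e0 rank2; rewrite e0 oppr0 in MN.
    have nz_b2 : b2 != 0.
      apply: contra_eq_neq rank2 => b20; rewrite (congruent_rank MN) b20.
      by rewrite neq_ltn ltnS rank_row2_eq0.
    split; last exact: smooth_curve_nonsingular.
    rewrite -[X in B_equiv G X]Gpoly_square_rank2; apply: congruent_B_equiv.
    exact: congruent_trans MN (congruent_square_rank2 _ nz_a nz_b2).
  + move=> /eqP; rewrite det_e => /eqP e0 rank1; rewrite e0 oppr0 in MN.
    have b20 : b2 = 0.
      apply/eqP; apply: contra_eqT rank1 => nz_b2.
      rewrite (congruent_rank MN) (@rank_minor _ _ o30 o32) //.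
      by rewrite !mxE /= mulr0 subr0 mulf_neq0.
    split; last exact: pencil_with_double_line.
    rewrite -[X in B_equiv G X]Gpoly_square_rank1; apply: congruent_B_equiv.
    rewrite b20 in MN; exact: congruent_trans MN (congruent_square_rank1 _ nz_a).
- move=> g0; have [e [a2 [b2 M_eq]]] := zero_gpoly_form g0.
  have det_e : (\det M' == 0) = (e == 0).
    by rewrite /M' M_eq lpart_mx23 det_mx22 mulr0 sub0r mulrN opprK mulf_eq0 orbb.
  split.
  + by move=> _; exact: pzeros_Gpoly_alternating.
  + rewrite det_e => nz_e; rewrite vec3_001; split; last exact: union_of_pencil.
    rewrite -[X in B_equiv G X]Gpoly_alternating; apply: congruent_B_equiv.
    by rewrite M_eq; exact: congruent_alternating.
  + move=> [N [gN0 /eqP det0 rank2]]; have [d [c2 [d2 N_eq]]] := zero_gpoly_form gN0.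
    move: det0 rank2; rewrite N_eq lpart_mx23 det_mx22.
    rewrite mulr0 sub0r mulrN opprK mulf_eq0 orbb.
    move=> /eqP->; rewrite oppr0 => rank2.
    by have := rank_lpart_eq0 c2 d2; rewrite rank2.
  + move=> /eqP; rewrite det_e => /eqP e0 rank1; rewrite e0 oppr0 in M_eq.
    rewrite vec3_010; split; last exact: (@union_of_pencil F o30 o32 o31).
    rewrite -[X in B_equiv G X]Gpoly_last_column; apply: congruent_B_equiv.
    rewrite M_eq; apply: congruent_last_column; rewrite -negb_and.
    apply: contra_eqN rank1 => /andP[/eqP a20 /eqP b20].
    rewrite M_eq a20 b20 (_ : mx23 0 0 0 0 0 0 = 0) ?mxrank0 //.
    by apply/matrixP; elim/ord2P; elim/ord3P; rewrite !mxE.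
Qed.
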